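(* Let $V$ be a multiply local OPE-algebra. Then $\mathcal{F}_Y=Y(V)$ is closed under the products $a(\vec z)_{(\vec n)}b(\vec z)$, $\vec n\in\mathbb{K}^2$, and $Y:V\to\mathcal{F}_Y$ is an isomorphism of OPE-algebras; that is, $Y$ is bijective, $Y(a_{(\vec n)}b)=Y(a)_{(\vec n)}Y(b)$ for all $a,b\in V$, $\vec n\in\mathbb{K}^2$, and $Y(1)=\mathrm{id}_V$.
   Context: $\mathbb{K}$ is a field of characteristic $0$; vector spaces are super, $\tilde a$ is parity, $\zeta:=-1$. For $n\in\mathbb{K}$, $x^{(n)}:=x^n/n!$ if $n\in\mathbb{N}$, else $0$. $\vec z=(z,\bar z)$; for $\vec n\in\mathbb{K}^2$, $\vec z^{\vec n}=z^n\bar z^{\bar n}$, $\partial_{\vec z}^{(\vec n)}=\partial_z^{(n)}\partial_{\bar z}^{(\bar n)}$, $1=(1,1)$ in exponents. $E\{\vec z\}$: formal sums $\sum_{\vec n\in\mathbb{K}^2}a_{\vec n}\vec z^{-\vec n-1}$; $E[[\vec z]]$: power series; $E\langle\vec z_1,\dots,\vec z_r\rangle$: the submodule generated by power series under multiplication by monomials $\vec z_i^{\vec m}$, $\vec m\in\mathbb{K}^2$. Fields: $a$ with $a v\in E\langle\dots\rangle$ for all $v$; $\mathcal{F}_r(E)$, $\mathcal{F}(E)=\mathcal{F}_1(E)$. $(\vec z-\vec w)^{\vec n}:=\sum_{\vec i\in\mathbb{N}^2}(-1)^{i+\bar i}\binom{n}{i}\binom{\bar n}{\bar i}\vec z^{\vec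 n-\vec i}\vec w^{\vec i}$; $\mathbb{K}^2_{\mathrm{int}}:=\{\vec n:n-\bar n\in\mathbb{Z}\}$; $(\vec z-\vec w)^{\vec n}_{w>z}:=(-1)^{n-\bar n}(\vec w-\vec z)^{\vec n}$. Local pair, OPE, product: $a,b$ local if $a(\vec z)b(\vec w)=\sum_ic^i(\vec z,\vec w)(\vec z-\vec w)^{-\vec h_i}$ and $\zeta^{\tilde a\tilde b}b(\vec w)a(\vec z)=\sum_ic^i(\vec z,\vec w)(\vec z-\vec w)_{w>z}^{-\vec h_i}$ with $c^i\in\mathcal{F}_2(E)$, $\vec h_i\in\mathbb{K}^2_{\mathrm{int}}$; $a(\vec w)_{(\vec n)}b(\vec w):=\sum_i\partial_{\vec z}^{(\vec h_i-1-\vec n)}c^i(\vec z,\vec w)|_{\vec z=\vec w}$. Multiple locality: with $(\vec z_i-\vec z_j)^{\vec n}_\sigma$ equal to $(\vec z_i-\vec z_j)^{\vec n}$ if $\sigma^{-1}(i)<\sigma^{-1}(j)$ and to $(\vec z_i-\vec z_j)^{\vec n}_{z_j>z_i}$ otherwise, $a^1,\dots,a^r$ are multiply local if there exist $\vec h^k_{ij}\in\mathbb{K}^2_{\mathrm{int}}$ ($i<j$, $k\le r_{ij}$) and $c^\alpha\in\mathcal{F}_r(E)$, $\alpha\in\prod_{i<j}\{1,..,r_{ij}\}$, with $\zeta'a^{\sigma1}(\vec z_{\sigma1})\cdots a^{\sigma r}(\vec z_{\sigma r})=\sum_\alpha c^\alpha(\vec z_1,..,\vec z_r)\prod_{i<j}(\vec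 z_i-\vec z_j)_\sigma^{-\vec h^{\alpha(i,j)}_{ij}}$ for all $\sigma\in S_r$ ($\zeta'$ the Koszul sign). OPE-algebra: a vector space $V$ with even products $a_{(\vec n)}b$ ($\vec n\in\mathbb{K}^2$), $Y(a):=\sum_{\vec n}a_{(\vec n)}\vec z^{-\vec n-1}$, $\mathcal{F}_Y=Y(V)$, such that there exist even commuting $T,\bar T\in\mathrm{End}(V)$ with $[T,Y(a)]=\partial_zY(a)$, $[\bar T,Y(a)]=\partial_{\bar z}Y(a)$ for all $a$, and an even $1\in V$ with $T1=\bar T1=0$, $Y(a)1\in V[[\vec z]]$ and $a_{(-1,-1)}1=a$ for all $a$, and such that $\mathcal{F}_Y$ is local (every pair local). $V$ is multiply local if every finite family in $\mathcal{F}_Y$ is multiply local. *)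

(* Defs.v *)
From HB Require Import structures.
From mathcomp Require Import all_boot all_order fingroup perm all_algebra.
From mathcomp Require Import boolp classical_sets fsbigop.

Set Implicit Arguments.
Unset Strict Implicit.
Unset Printing Implicit Defensive.
Import Order.TTheory GRing.Theory Num.Theory.
Local Open Scope classical_set_scope.
Local Open Scope ring_scope.

Section Scalars.
Variable K : fieldType.

Definition natK (x : K) : Prop := exists k : nat, x = k%:R.
Definition intK (x : K) : Prop := exists k : int, x = k%:~R.
Definition Kint2 (h : K * K) : Prop := intK (h.1 - h.2).

Definition add2 (a b : K * K) : K * K := (a.1 + b.1, a.2 + b.2).
Definition opp2 (a : K * K) : K * K := (- a.1, - a.2).
Definition sub2 (a b : K * K) : K * K := add2 a (opp2 b).
Definition one2 : K * K := (1, 1).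
Definition nat2K (k : nat * nat) : K * K := (k.1%:R, k.2%:R).

Definition binK (x : K) (k : nat) : K :=
  (\prod_(j < k) (x - j%:R)) / (k`!)%:R.

(* binom(x, m) for m \in K, with the convention (divided powers) that it is
   0 when m \notin N.  In characteristic 0 the index set below is empty or
   a singleton {k} with m = k, so this is binK x k if m = k \in N, else 0. *)
Definition binKK (x m : K) : K :=
  \sum_(k \in [set k : nat | m = k%:R]) binK x k.

(* (-1)^x for x \in Z (only used on integers) *)
Definition sgnK (x : K) : K :=
  if `[< exists k : int, x = (2 * k)%:~R >] then 1 else -1.

End Scalars.

(* Formal series E{z_1,...,z_r} with exponents in (K^2)^r.                   *)
(* A series is given by the function  exponent |-> coefficient  (the        *)
(* coefficient of the monomial \prod_i \vec z_i^{e i}).                      *)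
Section Series.
Variables (K : fieldType) (E : lmodType K).

Definition expo (r : nat) := 'I_r -> K * K.
Definition ser (r : nat) := expo r -> E.

Definition upd r (e : expo r) (i : 'I_r) (x : K * K) : expo r :=
  fun l => if l == i then add2 (e l) x else e l.

Definition is_pser r (f : ser r) : Prop :=
  forall e, f e != 0 -> forall i, natK (e i).1 /\ natK (e i).2.

(* multiplication by the monomial \prod_i \vec z_i^{m i} *)
Definition shiftm r (m : expo r) (f : ser r) : ser r :=
  fun e => f (fun l => sub2 (e l) (m l)).

(* E<z_1,..,z_r>: the submodule generated by the power series under
   multiplication by monomials = finite sums of monomials times power series *)
Definition in_lser r (f : ser r) : Prop :=
  exists (N : nat) (m : 'I_N -> expo r) (g : 'I_N -> ser r),
    (forall j, is_pser (g j)) /\ f = fun e => \sum_(j < N) shiftm (m j) (g j) e.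

(* multiplication by the expansion
   (z_i - z_j)^n = \sum_{k \in N^2} (-1)^{k+\bar k} binom(n,k) binom(\bar n,\bar k)
                    z_i^{n-k} z_j^k     (i <> j) *)
Definition mulpow r (i j : 'I_r) (n : K * K) (f : ser r) : ser r :=
  fun e => \sum_(k \in [set: nat * nat])
     ((-1) ^+ (k.1 + k.2) * binK n.1 k.1 * binK n.2 k.2)
       *: f (upd (upd e i (opp2 (sub2 n (nat2K K k)))) j (opp2 (nat2K K k))).

(* multiplication by (z_i - z_j)^n_{z_j > z_i} := (-1)^{n - \bar n} (z_j - z_i)^n *)
Definition mulpow_rev r (i j : 'I_r) (n : K * K) (f : ser r) : ser r :=
  fun e => sgnK (n.1 - n.2) *: mulpow j i n f e.

(* Fields: End(E){z_1..z_r}, coefficientwise operators                       *)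
Definition fld (r : nat) := expo r -> E -> E.

Definition app r (a : fld r) (v : E) : ser r := fun e => a e v.

Definition is_field r (a : fld r) : Prop :=
  (forall e (k : K) (x y : E), a e (k *: x + y) = k *: a e x + a e y) /\
  (forall v, in_lser (app a v)).

Definition e1 (x : K * K) : expo 1 := fun _ => x.

End Series.

Arguments expo K r : clear implicits.
Arguments fld K E r : clear implicits.
Arguments ser K E r : clear implicits.

(* The super structure of V is given by the parity involution sigma         *)
(* (sigma = id on V_0, -id on V_1).                                         *)
Section Locality.
Variables (K : fieldType) (V : lmodType K) (sigma : V -> V).

Definition z0 : 'I_2 := ord0.
Definition z1 : 'I_2 := ord_max.

Definition prod2 (a b : fld K V 1) : fld K V 2 :=
  fun e v => a (e1 (e z0)) (b (e1 (e z1)) v).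
Definition prod2r (a b : fld K V 1) : fld K V 2 :=
  fun e v => b (e1 (e z1)) (a (e1 (e z0)) v).

(* the parity-p component of a field (p = false: even, true: odd) *)
Definition compf r (p : bool) (a : fld K V r) : fld K V r :=
  fun e v => 2%:R^-1 *: (a e v + (-1) ^+ p *: sigma (a e (sigma v))).

(* OPE of homogeneous fields a, b of parities p, q:
   a(z)b(w) = \sum_i c^i(z,w) (z-w)^{-h_i},
   (-1)^{pq} b(w)a(z) = \sum_i c^i(z,w) (z-w)^{-h_i}_{w>z},
   c^i \in F_2(V), h_i \in K^2_int. *)
Definition ope_decomp (p q : bool) (a b : fld K V 1) (N : nat)
    (h : 'I_N -> K * K) (c : 'I_N -> fld K V 2) : Prop :=
  (forall i, Kint2 (h i)) /\ (forall i, is_field (c i)) /\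
  forall v,
    app (prod2 a b) v = (fun e => \sum_(i < N) mulpow z0 z1 (opp2 (h i)) (app (c i) v) e) /\
    (fun e => (-1) ^+ (p && q) *: app (prod2r a b) v e)
      = (fun e => \sum_(i < N) mulpow_rev z0 z1 (opp2 (h i)) (app (c i) v) e).

Definition local_hom (p q : bool) (a b : fld K V 1) : Prop :=
  exists N h c, @ope_decomp p q a b N h c.

Definition local (a b : fld K V 1) : Prop :=
  forall p q, local_hom p q (compf p a) (compf q b).

(* a(w)_(n) b(w) := \sum_i \partial_z^{(h_i - 1 - n)} c^i(z,w) |_{z=w} *)
Definition nprod_of (N : nat) (h : 'I_N -> K * K) (c : 'I_N -> fld K V 2)
    (n : K * K) : fld K V 1 :=
  fun e v => \sum_(i < N)
    let m := sub2 (sub2 (h i) (one2 K)) n in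
    \sum_(u \in [set: K * K])
      (binKK (u.1 + m.1) m.1 * binKK (u.2 + m.2) m.2)
        *: c i (fun l => if l == z0 then add2 u m else sub2 (e ord0) u) v.

Definition is_nprod_hom (p q : bool) (a b : fld K V 1) (n : K * K)
    (d : fld K V 1) : Prop :=
  local_hom p q a b /\
  forall N h c, @ope_decomp p q a b N h c -> d = nprod_of h c n.

(* products of general local fields: bilinear extension over the
   homogeneous components *)
Definition is_nprod (a b : fld K V 1) (n : K * K) (d : fld K V 1) : Prop :=
  exists dd : bool -> bool -> fld K V 1,
    (forall p q, is_nprod_hom p q (compf p a) (compf q b) n (dd p q)) /\
    d = fun e v => \sum_(p : bool) \sum_(q : bool) dd p q e v.

Definition mprod r (a : 'I_r -> fld K V 1) (s : {perm 'I_r}) : fld K V r :=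
  fun e v => foldr (fun l w => a (s l) (e1 (e (s l))) w) v (enum 'I_r).

(* Koszul sign of reordering homogeneous a^1..a^r (parities par) as
   a^{s 1} ... a^{s r} *)
Definition koszul r (par : 'I_r -> bool) (s : {perm 'I_r}) : K :=
  (-1) ^+ #|[set p : 'I_r * 'I_r |
      [&& (p.1 < p.2)%N, ((s^-1)%g p.2 < (s^-1)%g p.1)%N, par p.1 & par p.2]]|.

Definition mulpow_s r (s : {perm 'I_r}) (i j : 'I_r) (n : K * K)
    (f : ser K V r) : ser K V r :=
  if ((s^-1)%g i < (s^-1)%g j)%N then mulpow i j n f else mulpow_rev i j n f.

(* f * \prod_{i<j} (z_i - z_j)^{-H i j}_s, the product of expansions taken
   in the region |z_{s 1}| > ... > |z_{s r}|; the factors are multiplied in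
   by increasing position k of the "small" variable z_{s k}, which keeps all
   the coefficient sums finite. *)
Definition mulprod_s r (s : {perm 'I_r}) (H : 'I_r -> 'I_r -> K * K)
    (f : ser K V r) : ser K V r :=
  foldl (fun g (lk : 'I_r * 'I_r) =>
           let x := s lk.1 in let y := s lk.2 in
           if (x < y)%N then mulpow_s s x y (opp2 (H x y)) g
           else mulpow_s s y x (opp2 (H y x)) g)
        f [seq (l, k) | k : 'I_r <- enum 'I_r, l : 'I_r <- filter (fun l : 'I_r => (l < k)%N) (enum 'I_r)].

(* homogeneous a^1..a^r (parities par) multiply local.  The finite sum over
   alpha \in \prod_{i<j} {1..r_ij} with exponents h^{alpha(i,j)}_{ij} is
   encoded by a finite family alpha < N with exponent tuples H alpha. *)
Definition mlocal_hom r (par : 'I_r -> bool) (a : 'I_r -> fld K V 1) : Prop :=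
  exists (N : nat) (H : 'I_N -> 'I_r -> 'I_r -> K * K) (c : 'I_N -> fld K V r),
    (forall al (i j : 'I_r), (i < j)%N -> Kint2 (H al i j)) /\
    (forall al, is_field (c al)) /\
    forall (s : {perm 'I_r}) v,
      (fun e => koszul par s *: mprod a s e v)
        = (fun e => \sum_(al < N) mulprod_s s (H al) (app (c al) v) e).

Definition mlocal r (a : 'I_r -> fld K V 1) : Prop :=
  forall par : 'I_r -> bool, mlocal_hom par (fun k => compf (par k) (a k)).

End Locality.

(* prod n a b = a_(n) b ;  Y(a) = \sum_n a_(n) z^{-n-1}, i.e. the           *)
(* coefficient of z^e in Y(a) is a_(-e-1).                                  *)
Section OPE.
Variables (K : fieldType) (V : lmodType K).

Definition Y (prod : K * K -> V -> V -> V) (a : V) : fld K V 1 :=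
  fun e v => prod (sub2 (opp2 (e ord0)) (one2 K)) a v.

Definition idfield : fld K V 1 :=
  fun e v => if e ord0 == (0, 0) then v else 0.

Definition is_lin (f : V -> V) : Prop :=
  forall (k : K) x y, f (k *: x + y) = k *: f x + f y.

Definition OPE_algebra (sigma : V -> V) (prod : K * K -> V -> V -> V)
    (T Tb : V -> V) (one : V) : Prop :=
  (is_lin sigma /\ (forall v, sigma (sigma v) = v)) /\
      ((forall n a, is_lin (prod n a)) /\ (forall n b, is_lin (prod n ^~ b)) /\
      (forall n a b, sigma (prod n a b) = prod n (sigma a) (sigma b))) /\
      [/\ is_lin T, is_lin Tb, (forall v, T (Tb v) = Tb (T v)),
          (forall v, sigma (T v) = T (sigma v)) &
          (forall v, sigma (Tb v) = Tb (sigma v))] /\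
      (* [T, Y(a)] = \partial_z Y(a), [Tb, Y(a)] = \partial_{\bar z} Y(a) *)
      ((forall a e v, T (Y prod a e v) - Y prod a e (T v)
                       = ((e ord0).1 + 1) *: Y prod a (e1 (add2 (e ord0) (1, 0))) v) /\
      (forall a e v, Tb (Y prod a e v) - Y prod a e (Tb v)
                       = ((e ord0).2 + 1) *: Y prod a (e1 (add2 (e ord0) (0, 1))) v)) /\
      [/\ sigma one = one, T one = 0, Tb one = 0,
          (forall a, is_pser (app (Y prod a) one)) &
          (forall a, prod (opp2 (one2 K)) a one = a)] /\
      (forall a b, local sigma (Y prod a) (Y prod b)).

Definition multiply_local (sigma : V -> V) (prod : K * K -> V -> V -> V) : Prop :=
  forall (r : nat) (a : 'I_r -> V), mlocal sigma (fun k => Y prod (a k)).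

End OPE.

(* Main.v *)
Require Import Defs.
From HB Require Import structures.
From mathcomp Require Import all_boot all_order fingroup perm all_algebra.
From mathcomp Require Import boolp classical_sets fsbigop cardinality ring zify.

(**
Fix the total degree [D].  A series in [V<z,w>] then has only finitely many
terms, so a sum of series [f_i(z,w) (z-w)^{s_i}] is a finite list of triples
[(s, q, v)] standing for [v z^{D-s-q} w^q (z-w)^s].  With [x = w/z], the
expansion in [|z| > |w|] is a combination of [x^q (1-x)^s]; since binomials
span the polynomials in [s], the functions [(1-x)^s] with distinct [s] are
linearly independent, and hence that expansion determines the value of every
functional compatible with [x (1-x)^s = (1-x)^s - (1-x)^(s+1)].  Two such
functionals are the [n]-th product and the expansion in [|w| > |z|].

Let [d = Y(a)_(n) Y(b)] and [y = a_(n) b].  Applying this to the triple OPE of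
[a], [b], [x] on the vacuum, in the orders [(a,b,x)] and [(x,a,b)], the Leibniz
rule shows that [d] is local to [Y(x)] on the vacuum (Dong's lemma).  From
[a(z) e^{wT} b = e^{wT} a(z-w) b] one gets [d(w) 1 = Y(y)(w) 1].  So
[x(u) d(w) 1 = x(u) Y(y)(w) 1], and by uniqueness of expansions
[d(w) x(u) 1 = Y(y)(w) x(u) 1]; the constant term in [u] is [d x = Y(y) x]
(Goddard's uniqueness).  The same argument gives [Y(1) = id].
*)

Set Implicit Arguments.
Unset Strict Implicit.
Unset Printing Implicit Defensive.
Import Order.TTheory GRing.Theory.
Local Open Scope classical_set_scope.
Local Open Scope ring_scope.

(** * Binomial coefficients *)

Section Binomials.
Variable K : fieldType.
Hypothesis char0 : [pchar K] =i pred0.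

Lemma natr_eq0 n : ((n%:R : K) == 0) = (n == 0)%N.
Proof. exact: (pcharf0P K).1. Qed.

Lemma natr_injK : injective (fun n : nat => n%:R : K).
Proof.
move=> m n /eqP; wlog le_mn : m n / (m <= n)%N => [H|].
  by case/orP: (leq_total m n) => [/H//|/H h e]; rewrite h // eq_sym.
rewrite eq_sym -subr_eq0 -natrB // natr_eq0 subn_eq0 => le_nm.
by apply/eqP; rewrite eqn_leq le_mn.
Qed.

Lemma factr_neq0 n : (n`!)%:R != 0 :> K.
Proof. by rewrite natr_eq0 -lt0n fact_gt0. Qed.

Lemma natrS_neq0 n : (n.+1)%:R != 0 :> K.
Proof. by rewrite natr_eq0. Qed.

Lemma binK0 (x : K) : binK x 0 = 1.
Proof. by rewrite /binK big_ord0 fact0 divr1. Qed.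

Lemma binKS (x : K) k : binK x k.+1 * k.+1%:R = (x - k%:R) * binK x k.
Proof.
rewrite /binK big_ord_recr /= factS natrM.
move: (factr_neq0 k) (natrS_neq0 k); move: (k`!%:R) (k.+1%:R) => a b nza nzb.
by field; rewrite nza nzb.
Qed.

Lemma binKS_absorb (x : K) k : binK (x + 1) k.+1 * k.+1%:R = (x + 1) * binK x k.
Proof.
rewrite /binK big_ord_recl /= factS natrM.
rewrite (eq_bigr (fun i : 'I_k => x - i%:R)); last first.
  by move=> i _; rewrite /bump /= natrD; ring.
move: (factr_neq0 k) (natrS_neq0 k); move: (k`!%:R) (k.+1%:R) => a b nza nzb.
by field; rewrite nza nzb.
Qed.

Lemma binK_pascal (x : K) k : binK (x + 1) k.+1 = binK x k.+1 + binK x k.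
Proof.
apply: (mulIf (natrS_neq0 k)); rewrite mulrDl binKS_absorb binKS -natr1; ring.
Qed.

Lemma binK_nat n k : binK n%:R k = 'C(n, k)%:R :> K.
Proof.
elim: n k => [|n IHn] [|k]; rewrite ?binK0 ?bin0 //.
  by rewrite /binK big_ord_recl subr0 mul0r mul0r.
by rewrite -natr1 binK_pascal !IHn binS natrD.
Qed.

Lemma binK_gt (n k : nat) : (n < k)%N -> binK n%:R k = 0 :> K.
Proof. by move=> lt_nk; rewrite binK_nat bin_small. Qed.

Lemma binK_add (x : K) i j :
  binK x (i + j) * ((i + j)`!)%:R = binK x i * i`!%:R * (binK (x - i%:R) j * j`!%:R).
Proof.
rewrite /binK !divfK ?factr_neq0 // big_split_ord /=; congr (_ * _).
by apply: eq_bigr => k _; rewrite natrD; ring.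
Qed.

(** Both sides times [i! j!] are the falling factorial of length [i + j], which is symmetric in [i]
    and [j]. *)
Lemma binK_trinomial (x : K) i j :
  binK x i * binK (x - i%:R) j = binK x j * binK (x - j%:R) i.
Proof.
have nz : i`!%:R * j`!%:R != 0 :> K by rewrite mulf_neq0 ?factr_neq0.
apply: (mulIf nz); transitivity (binK x (i + j) * ((i + j)`!)%:R).
  by rewrite binK_add; ring.
by rewrite addnC binK_add; ring.
Qed.

Lemma binK_mul_bin (x : K) i j :
  binK x (i + j) * binK (i + j)%:R i = binK x i * binK (x - i%:R) j.
Proof.
have nz : i`!%:R * j`!%:R != 0 :> K by rewrite mulf_neq0 ?factr_neq0.
apply: (mulIf nz); rewrite binK_nat.
have := bin_fact (leq_addr j i); rewrite addKn => /(congr1 (fun n => n%:R : K)).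
rewrite !natrM -mulrA => ->; rewrite binK_add; ring.
Qed.

(** Induction on [n]. After multiplication by [n + 1], the factor [x + y - n] splits as
    [(x - k) + (y - (n - k))], and each half raises one binomial by one degree; the resulting
    weights [k] and [n + 1 - k] add up to [n + 1]. *)
Lemma binK_vandermonde (x y : K) n :
  \sum_(k < n.+1) binK x k * binK y (n - k) = binK (x + y) n.
Proof.
elim: n => [|n IHn]; first by rewrite big_ord1 subnn !binK0 mulr1.
apply: (mulIf (natrS_neq0 n)); rewrite binKS -IHn mulr_suml mulr_sumr.
pose A (k : nat) := (x - k%:R) * binK x k * binK y (n - k).
pose B (k : nat) := binK x k * ((y - (n - k)%:R) * binK y (n - k)).
transitivity (\sum_(k < n.+1) A k + \sum_(k < n.+1) B k); last first.
  rewrite -big_split /=; apply: eq_bigr => k _; rewrite /A /B natrB -1?ltnS //; ring.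
rewrite [X in _ + X](_ : _ = \sum_(k < n.+2)
    binK x k * binK y (n.+1 - k) * (n.+1 - k)%:R); last first.
  rewrite [RHS]big_ord_recr /= subnn mulr0 addr0.
  by apply: eq_bigr => k _; rewrite /B -binKS subSn ?mulrA // -ltnS.
rewrite [X in X + _](_ : _ = \sum_(k < n.+2)
    binK x k * binK y (n.+1 - k) * k%:R); last first.
  rewrite [RHS]big_ord_recl /= mulr0 add0r.
  by apply: eq_bigr => k _; rewrite /A -binKS /bump /= add1n subSS; ring.
rewrite -big_split /=; apply: eq_bigr => k _.
by rewrite -mulrDr -natrD subnKC // -ltnS.
Qed.

(** The coefficient of [t^k] in [(1 - t)^x]. *)
Definition sbin (x : K) (k : nat) : K := (-1) ^+ k * binK x k.

Lemma sbin_vandermonde (x y : K) n :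
  \sum_(k < n.+1) sbin x k * sbin y (n - k) = sbin (x + y) n.
Proof.
rewrite /sbin -binK_vandermonde mulr_sumr; apply: eq_bigr => k _.
by rewrite mulrACA -exprD subnKC // -ltnS.
Qed.

(* The coefficient identity behind the Leibniz rule for
   [d_z^(M) (z^p (z-u)^x)] at [z = w], expanded in [|w| > |u|]. *)
Lemma leibniz_expand (x y p : K) M n :
  \sum_(k < n.+1) sbin y k * sbin x (n - k) * binK (p + x - (n - k)%:R) M
  = \sum_(j < M.+1) binK p (M - j) * binK x j * sbin (x + y - j%:R) n.
Proof.
transitivity (\sum_(k < n.+1) \sum_(j < M.+1)
   binK p (M - j) * binK x j * (sbin y k * sbin (x - j%:R) (n - k))).
  apply: eq_bigr => k _; rewrite -addrA addrC -binK_vandermonde mulr_sumr.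
  apply: eq_bigr => j _; rewrite /sbin.
  transitivity ((-1) ^+ k * binK y k * (-1) ^+ (n - k) * binK p (M - j) *
     (binK x (n - k) * binK (x - (n - k)%:R) j)); first by ring.
  by rewrite binK_trinomial; ring.
rewrite exchange_big /=; apply: eq_bigr => j _.
by rewrite -mulr_sumr sbin_vandermonde; congr (_ * sbin _ _); ring.
Qed.

(* The same for the expansion in [|u| > |w|]. *)
Lemma leibniz_expand_rev (x y p : K) M n :
  \sum_(k < n.+1) sbin y k * sbin x (n - k) * binK (p + (n - k)%:R) M
  = \sum_(j < M.+1) binK p (M - j) * binK x j *
      ((-1) ^+ j * (if (j <= n)%N then sbin (x + y - j%:R) (n - j) else 0)).
Proof.
transitivity (\sum_(k < n.+1) \sum_(j < M.+1)
   binK p (M - j) * (sbin y k * sbin x (n - k) * binK (n - k)%:R j)).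
  apply: eq_bigr => k _; rewrite addrC -binK_vandermonde mulr_sumr.
  by apply: eq_bigr => j _; ring.
rewrite exchange_big /=; apply: eq_bigr => j _.
rewrite -mulr_sumr -[RHS]mulrA; congr (_ * _).
(* For [n < j] every binomial of [n - k] over [j] vanishes, in agreement with the value 0 on the
   right. *)
case: leqP => [le_jn|lt_nj]; last first.
  rewrite !mulr0 big1 // => k _; rewrite binK_gt ?mulr0 //.
  by rewrite (leq_ltn_trans (leq_subr _ _)).
rewrite (_ : x + y - j%:R = y + (x - j%:R)); last by ring.
rewrite -sbin_vandermonde !mulr_sumr.
have le1 : ((n - j).+1 <= n.+1)%N by rewrite ltnS leq_subr.
rewrite [RHS](big_ord_widen n.+1
  (fun k => binK x j * ((-1) ^+ j * (sbin y k * sbin (x - j%:R) (n - j - k))))) //.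
rewrite [RHS]big_mkcond; apply: eq_bigr => k _.
case: ifP => [|/negbT]; last first.
  rewrite -leqNgt => lt_n; rewrite binK_gt ?mulr0 //.
  by have := ltn_ord k; lia.
rewrite ltnS => le_k.
have le_jk : (j <= n - k)%N by have := ltn_ord k; lia.
have E : (n - k = j + (n - j - k))%N by rewrite subnAC subnKC.
rewrite {1 2}E /sbin.
transitivity ((-1) ^+ k * binK y k * (-1) ^+ (j + (n - j - k)) *
  (binK x (j + (n - j - k)) * binK (j + (n - j - k))%:R j)); first by ring.
by rewrite binK_mul_bin exprD; ring.
Qed.

End Binomials.

(** * Binomials with lower entry in K *)

Section NaturalArguments.
Variable K : fieldType.
Hypothesis char0 : [pchar K] =i pred0.

(** Outside N the default value is 0. *)
Definition natof (x : K) : nat := xget 0%N [set k | x = k%:R].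

Lemma natofE x : natK x -> x = (natof x)%:R.
Proof. by case=> k xk; rewrite /natof; case: xgetP => // /(_ k). Qed.

Lemma natof_nat n : natof n%:R = n.
Proof. by apply: (natr_injK char0); rewrite -natofE //; exists n. Qed.

Lemma natK_nat n : natK (n%:R : K). Proof. by exists n. Qed.

Lemma natKD (x y : K) : natK x -> natK y -> natK (x + y).
Proof. by move=> [m ->] [n ->]; exists (m + n)%N; rewrite natrD. Qed.

Lemma natK_pred (m : K) : natK (m + 1) -> m + 1 = 0 \/ natK m.
Proof.
case=> -[|k] E; first by left.
by right; exists k; apply: (addIr 1); rewrite E natr1.
Qed.

Definition ext (f : nat -> K) (m : K) : K := if `[<natK m>] then f (natof m) else 0.

Lemma ext_nat f k : ext f k%:R = f k.
Proof. by rewrite /ext asboolT ?natof_nat //; apply: natK_nat. Qed.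

Lemma ext_out f m : ~ natK m -> ext f m = 0.
Proof. by move=> nm; rewrite /ext asboolF. Qed.

Lemma binKKE (x m : K) : binKK x m = ext (binK x) m.
Proof.
rewrite /binKK; have [[k ->]|nm] := pselect (natK m).
  rewrite ext_nat (_ : [set _ | _] = [set k]) ?fsbig_set1 //.
  by apply/seteqP; split=> [i /= /(natr_injK char0)|i ->].
by rewrite ext_out // fsbig1 // => k /= mk; case: nm; exists k.
Qed.

Definition sb (x m : K) : K := ext (sbin x) m.

(** Besides natural [m], the case [m = -1] matters: there [m + 1] is the natural number 0, the first
    two binomials are 1 and the last one is 0. *)
Lemma binKK_pascal (x m : K) : binKK (x + 1) (m + 1) = binKK x (m + 1) + binKK x m.
Proof.
rewrite !binKKE; have [[k ->]|nm] := pselect (natK m).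
  by rewrite natr1 !ext_nat binK_pascal.
rewrite (ext_out _ nm) addr0.
have [/natK_pred[->|//]|nm1] := pselect (natK (m + 1)).
  by rewrite -[0]/(0%:R) !ext_nat !binK0.
by rewrite !ext_out.
Qed.

Lemma sb_pascal (x m : K) : sb (x + 1) (m + 1) = sb x (m + 1) - sb x m.
Proof.
rewrite /sb; have [[k ->]|nm] := pselect (natK m).
  rewrite natr1 !ext_nat /sbin binK_pascal // exprS; ring.
rewrite [X in _ - X](ext_out _ nm) subr0.
have [/natK_pred[->|//]|nm1] := pselect (natK (m + 1)).
  by rewrite -[0]/(0%:R) !ext_nat /sbin !binK0.
by rewrite !ext_out.
Qed.

Lemma sb00 : sb 0 0 = 1.
Proof. by rewrite /sb -[X in ext _ X]/(0%:R) ext_nat /sbin binK0 mulr1. Qed.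

Lemma sb0_eq0 (m : K) : m != 0 -> sb 0 m = 0.
Proof.
rewrite /sb; have [[[|k] ->]|nm] := pselect (natK m); rewrite ?eqxx // => _.
  rewrite ext_nat /sbin -[X in binK X _]/(0%:R) binK_gt ?mulr0 //.
by rewrite ext_out.
Qed.

Lemma binKK0 (m : K) : binKK 0 m = (m == 0)%:R.
Proof.
rewrite binKKE; have [[k ->]|nm] := pselect (natK m).
  by rewrite ext_nat -[X in binK X _]/(0%:R) binK_nat // bin0n natr_eq0.
rewrite ext_out //; case: eqP => // m0.
by case: nm; rewrite m0; exists 0%N.
Qed.

End NaturalArguments.

(** * Uniqueness of expansions *)

Section Independence.
Variables (K : fieldType) (V : lmodType K).
Hypothesis char0 : [pchar K] =i pred0.

Lemma big_seq_split (I : Type) (l : seq I) (C : pred I) (F : I -> V) :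
  \sum_(t <- l) F t
  = \sum_(t <- filter C l) F t + \sum_(t <- filter (predC C) l) F t.
Proof. by rewrite (bigID C) /= !big_filter. Qed.

(** With [C] for binomials, [x C(x,i) = (i+1) C(x,i+1) + i C(x,i)], so the vanishing is stable under
    multiplication by [x]. The polynomials are built up degree by degree, first in one coordinate
    and then in the other. *)
Lemma horner_sum0_of_binK (l : seq ((K * K) * V)) :
  (forall i j, \sum_(t <- l) (binK t.1.1 i * binK t.1.2 j) *: t.2 = 0) ->
  forall p q : {poly K}, \sum_(t <- l) (p.[t.1.1] * q.[t.1.2]) *: t.2 = 0.
Proof.
move=> H.
have H1 (p : {poly K}) : forall i j,
    \sum_(t <- l) (p.[t.1.1] * binK t.1.1 i * binK t.1.2 j) *: t.2 = 0.
  elim/poly_ind: p => [|p c IHp] i j.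
    by rewrite big1 // => t _; rewrite horner0 !mul0r scale0r.
  pose S k := \sum_(t <- l) (p.[t.1.1] * binK t.1.1 k * binK t.1.2 j) *: t.2.
  transitivity (i.+1%:R *: S i.+1 + i%:R *: S i
      + c *: \sum_(t <- l) (binK t.1.1 i * binK t.1.2 j) *: t.2); last first.
    by rewrite /S !IHp H !scaler0 !addr0.
  rewrite /S !scaler_sumr -!big_split /=.
  apply: eq_bigr => t _; rewrite !scalerA -!scalerDl hornerMXaddC; congr (_ *: _).
  transitivity (p.[t.1.1] * (binK t.1.1 i.+1 * i.+1%:R) * binK t.1.2 j
     + i%:R * (p.[t.1.1] * binK t.1.1 i * binK t.1.2 j)
     + c * (binK t.1.1 i * binK t.1.2 j)); last by ring.
  by rewrite binKS //; ring.
have H2 (q : {poly K}) : forall p j,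
    \sum_(t <- l) (p.[t.1.1] * (q.[t.1.2] * binK t.1.2 j)) *: t.2 = 0.
  elim/poly_ind: q => [|q c IHq] p j.
    by rewrite big1 // => t _; rewrite horner0 mul0r mulr0 scale0r.
  pose S k := \sum_(t <- l) (p.[t.1.1] * (q.[t.1.2] * binK t.1.2 k)) *: t.2.
  transitivity (j.+1%:R *: S j.+1 + j%:R *: S j
      + c *: \sum_(t <- l) (p.[t.1.1] * binK t.1.1 0 * binK t.1.2 j) *: t.2); last first.
    by rewrite /S !IHq H1 !scaler0 !addr0.
  rewrite /S !scaler_sumr -!big_split /=.
  apply: eq_bigr => t _; rewrite !scalerA -!scalerDl hornerMXaddC; congr (_ *: _).
  transitivity (p.[t.1.1] * q.[t.1.2] * (binK t.1.2 j.+1 * j.+1%:R)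
     + j%:R * (p.[t.1.1] * q.[t.1.2] * binK t.1.2 j)
     + c * (p.[t.1.1] * binK t.1.1 0 * binK t.1.2 j)); last by ring.
  by rewrite binKS // binK0; ring.
move=> p q; rewrite -[RHS](H2 q p 0%N); apply: eq_bigr => t _.
by rewrite binK0 mulr1.
Qed.

(** Interpolation: a polynomial that vanishes at all points of the list except [t0.1] shows that the
    vectors at that point add up to 0. Deleting them leaves a shorter list. *)
Lemma binK_independent (l : seq ((K * K) * V)) :
  (forall i j, \sum_(t <- l) (binK t.1.1 i * binK t.1.2 j) *: t.2 = 0) ->
  forall Phi : K * K -> K, \sum_(t <- l) Phi t.1 *: t.2 = 0.
Proof.
have [m] := ubnP (size l); elim: m l => // m IHm [|t0 l'] lt_m H Phi; first by rewrite big_nil.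
 set l := t0 :: l' in H *.
pose C : pred ((K * K) * V) := fun t => t.1 == t0.1.
have sum0 : \sum_(t <- l | C t) t.2 = 0.
  (* A point other than [t0.1] differs from it in the first or in the second coordinate; [p]
     vanishes in the one case and [q] in the other. *)
  pose p := \prod_(t <- l | t.1.1 != t0.1.1) ('X - t.1.1%:P).
  pose q := \prod_(t <- l | t.1.2 != t0.1.2) ('X - t.1.2%:P).
  have := horner_sum0_of_binK H p q; rewrite (bigID C) /= [X in _ + X]big1_seq; last first.
    move=> t /andP[Ct lt].
    have [e1|n1] := eqVneq t.1.1 t0.1.1.
      have n2 : t.1.2 != t0.1.2.
        by apply: contraNneq Ct => e2; rewrite /C [t.1]surjective_pairing e1 e2;
          apply/eqP; case: (t0.1).
      rewrite (_ : q.[_] = 0) ?mulr0 ?scale0r //; apply/eqP.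
      rewrite /q horner_prod; rewrite (big_rem t) //= n2 !hornerE subrr mul0r; exact: eqxx.
    rewrite (_ : p.[_] = 0) ?mul0r ?scale0r //; apply/eqP.
    rewrite /p horner_prod; rewrite (big_rem t) //= n1 !hornerE subrr mul0r; exact: eqxx.
  rewrite addr0 (eq_bigr (fun t => (p.[t0.1.1] * q.[t0.1.2]) *: t.2)); last first.
    by move=> t /eqP ->.
  rewrite -scaler_sumr => /eqP; rewrite scaler_eq0 => /orP[|/eqP//].
  rewrite mulf_eq0 !horner_prod !prodf_seq_eq0 => /orP[] /hasP[t _] /andP[n1];
  by rewrite !hornerE subr_eq0 eq_sym (negPf n1).
have C0 (F : K * K -> K) : \sum_(t <- filter C l) F t.1 *: t.2 = 0.
  rewrite big_filter (eq_bigr (fun t => F t0.1 *: t.2)); last by move=> t /eqP ->.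
  by rewrite -scaler_sumr sum0 scaler0.
rewrite (big_seq_split l C) C0 add0r; apply: IHm => [|i j].
  rewrite /l /= /C eqxx /= size_filter.
  exact: leq_ltn_trans (count_size _ _) (lt_m : (size l' < m)%N).
have := H i j; rewrite (big_seq_split l C) (C0 (fun s => binK s.1 i * binK s.2 j)).
by rewrite add0r.
Qed.

Definition triple := ((K * K) * (K * K) * V)%type.

(* A list of triples [(s, q, v)] stands for the series
   [\sum v z^{D - s - q} w^q (z - w)^s], homogeneous of degree [D]. *)
Definition ev (L : K * K -> K * K -> K) (l : seq triple) : V :=
  \sum_(t <- l) L t.1.1 t.1.2 *: t.2.

Lemma ev_cat L l1 l2 : ev L (l1 ++ l2) = ev L l1 + ev L l2.
Proof. by rewrite /ev big_cat. Qed.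

Lemma ev_flatten L (I : Type) (F : I -> seq triple) (r : seq I) :
  ev L (flatten [seq F i | i <- r]) = \sum_(i <- r) ev L (F i).
Proof. elim: r => [|i r IHr] /=; first by rewrite /ev !big_nil.
by rewrite ev_cat big_cons IHr. Qed.

Lemma ev_map L (I : Type) (F : I -> triple) (r : seq I) :
  ev L [seq F i | i <- r] = \sum_(i <- r) L (F i).1.1 (F i).1.2 *: (F i).2.
Proof. by rewrite /ev big_map. Qed.

Definition oppl (l : seq triple) : seq triple := [seq (t.1, - t.2) | t <- l].

Lemma ev_oppl L l : ev L (oppl l) = - ev L l.
Proof. by rewrite ev_map /ev -sumrN; apply: eq_bigr => t _; rewrite scalerN. Qed.

(* Invariance under [x (1-x)^s = (1-x)^s - (1-x)^(s+1)], i.e. under rewriting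
   [w (z-w)^s] as [z (z-w)^s - (z-w)^(s+1)]. *)
Definition admissible (L : K * K -> K * K -> K) : Prop :=
  (forall s q, L s (q.1 + 1, q.2) = L s q - L (s.1 + 1, s.2) q) /\
  (forall s q, L s (q.1, q.2 + 1) = L s q - L (s.1, s.2 + 1) q).

Definition cfbin (j l : nat) : K := (-1) ^+ l * 'C(j, l)%:R.

(** With [q + 1] read as multiplication by [x] and [s + 1] as multiplication by [1 - x], this is the
    expansion of [x^j = (1 - (1 - x))^j]. *)
Lemma shift_recurrence (L : K -> K -> K) :
  (forall s q, L s (q + 1) = L s q - L (s + 1) q) ->
  forall j s q, L s (q + j%:R) = \sum_(l < j.+1) cfbin j l * L (s + l%:R) q.
Proof.
move=> HL; elim=> [|j IHj] s q.
  by rewrite big_ord1 /cfbin bin0 mulr1 mul1r !addr0.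
rewrite -natr1 addrA HL !IHj [RHS]big_ord_recl /=.
rewrite [X in _ = _ + X](eq_bigr (fun l : 'I_j.+1 => cfbin j l.+1 * L (s + l.+1%:R) q
   - cfbin j l * L (s + l.+1%:R) q)); last first.
  by move=> l _; rewrite /bump /= add1n /cfbin binS natrD exprS; ring.
rewrite sumrB /= addrA; congr (_ - _); last first.
  by apply: eq_bigr => l _; rewrite -addrA -natr1 [1 + _]addrC.
rewrite big_ord_recl /= [in RHS]/cfbin /= !bin0 {1}/cfbin bin0; congr (_ + _).
rewrite [RHS]big_ord_recr /= bin_small // mulr0 mul0r addr0.
by apply: eq_bigr => l _; rewrite /bump /= add1n.
Qed.

Lemma admissible_shift L : admissible L -> forall s q j j',
  L s (q.1 + j%:R, q.2 + j'%:R)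
  = \sum_(l < j.+1) \sum_(l' < j'.+1)
      (cfbin j l * cfbin j' l') * L (s.1 + l%:R, s.2 + l'%:R) q.
Proof.
move=> [HL HL'] [s s'] [q q'] j j' /=.
rewrite (@shift_recurrence (fun x y => L (x, s') (y, q' + j'%:R))); last first.
  by move=> x y; rewrite (HL (x, s') (y, _)).
apply: eq_bigr => l _.
rewrite (@shift_recurrence (fun x y => L (s + l%:R, x) (q, y))); last first.
  by move=> x y; rewrite (HL' (_, x) (_, y)).
by rewrite mulr_sumr; apply: eq_bigr => l' _; rewrite mulrA.
Qed.

Definition sb2 (s m : K * K) : K := sb s.1 m.1 * sb s.2 m.2.

(* The coefficient of [w^e] in the expansion of [w^q (z-w)^s] in [|z| > |w|]. *)
Definition Lexp (e s q : K * K) : K := sb2 s (sub2 e q).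

Lemma admissible_Lexp e : admissible (Lexp e).
Proof.
rewrite /Lexp /sb2; split=> -[s s'] [q q'] /=.
  by rewrite -mulrBl (_ : e.1 - q = e.1 - (q + 1) + 1) ?sb_pascal //; ring.
by rewrite -mulrBr (_ : e.2 - q' = e.2 - (q' + 1) + 1) ?sb_pascal //; ring.
Qed.

Definition same_coset (q0 q : K * K) : Prop := intK (q.1 - q0.1) /\ intK (q.2 - q0.2).

Lemma intK_nat (x : K) : natK x -> intK x.
Proof. by case=> k ->; exists k%:Z. Qed.

Lemma intKB (x y : K) : intK x -> intK y -> intK (x - y).
Proof. by move=> [m ->] [n ->]; exists (m - n); rewrite rmorphB. Qed.

Lemma intKN (x : K) : intK x -> intK (- x).
Proof. by move=> [m ->]; exists (- m); rewrite rmorphN. Qed.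

Lemma intK_natB (x : K) : intK x -> exists k : nat, natK (x + k%:R).
Proof.
case=> -[k ->|k ->]; first by exists 0%N; exists k; rewrite addr0.
by exists k.+1; exists 0%N; rewrite NegzE mulrNz addNr.
Qed.

(** The exponents of a finite list in one coset have a common lower bound [q1]; all terms can then
    be written with the single power [x^q1]. *)
Lemma coset_lower_bound q0 (l : seq triple) :
  (forall t, t \in l -> same_coset q0 t.1.2) ->
  exists2 q1, same_coset q0 q1 &
    forall t, t \in l -> natK (t.1.2.1 - q1.1) /\ natK (t.1.2.2 - q1.2).
Proof.
elim: l => [|t l IHl] Hl.
  by exists q0 => //; split; exists 0; rewrite subrr.
have [|q1 [i1 i2] Hq1] := IHl; first by move=> u ul; apply: Hl; rewrite inE ul orbT.
have [j1 j2] := Hl t (mem_head _ _).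
have [k nk] := intK_natB (intKB j1 i1); have [k' nk'] := intK_natB (intKB j2 i2).
exists (q1.1 - k%:R, q1.2 - k'%:R) => /=.
  by split=> /=; rewrite addrAC; apply: intKB => //; apply/intK_nat/natK_nat.
move=> u; rewrite inE => /orP[/eqP ->|/Hq1[n n']] /=.
  split; [move: nk|move: nk']; congr natK; ring.
by split; rewrite opprB addrA addrAC; apply: natKD => //; apply: natK_nat.
Qed.

Lemma Lexp_out e s q : ~ same_coset q e -> Lexp e s q = 0.
Proof.
move=> nc; rewrite /Lexp /sb2 /=.
have [i1|n1] := pselect (natK (e.1 - q.1)); last by rewrite /sb ext_out ?mul0r.
have [i2|n2] := pselect (natK (e.2 - q.2)); last by rewrite mulrC /sb ext_out ?mul0r.
by case: nc; split; apply: intK_nat.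
Qed.

(** Admissibility trades the excess of each exponent over [q1] for powers of [1 - x]. The expansion
    coefficients are then, up to sign, products of binomials in the exponents of [1 - x], and
    [binK_independent] applies. *)
Lemma ev_coset q1 (l : seq triple) :
  (forall t, t \in l -> natK (t.1.2.1 - q1.1) /\ natK (t.1.2.2 - q1.2)) ->
  (forall e, ev (Lexp e) l = 0) -> forall L, admissible L -> ev L l = 0.
Proof.
move=> Hq H0 L HL.
pose jj (t : triple) := natof (t.1.2.1 - q1.1).
pose jj' (t : triple) := natof (t.1.2.2 - q1.2).
pose l' := flatten [seq flatten [seq [seq
   ((t.1.1.1 + x%:R, t.1.1.2 + y%:R), (cfbin (jj t) x * cfbin (jj' t) y) *: t.2)
   | y <- index_iota 0 (jj' t).+1] | x <- index_iota 0 (jj t).+1] | t <- l].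
have E M : admissible M -> ev M l = \sum_(t <- l') M t.1 q1 *: t.2.
  move=> HM; rewrite /l' big_flatten big_map; apply: eq_big_seq => t tl.
  rewrite big_flatten big_map.
  have [/natofE E1 /natofE E2] := Hq t tl.
  have -> : t.1.2 = (q1.1 + (jj t)%:R, q1.2 + (jj' t)%:R).
    by rewrite -E1 -E2 !subrKC; case: (t.1.2).
  rewrite admissible_shift // big_mkord scaler_suml.
  apply: eq_bigr => x _; rewrite big_map big_mkord scaler_suml.
  by apply: eq_bigr => y _; rewrite scalerA [M _ _ * _]mulrC.
rewrite E //; apply: (binK_independent (l := l') _ (fun s => L s q1)) => i j.
transitivity (((-1) ^+ i * (-1) ^+ j) *: ev (Lexp (q1.1 + i%:R, q1.2 + j%:R)) l); last first.
  by rewrite H0 scaler0.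
rewrite (E _ (admissible_Lexp _)) scaler_sumr; apply: eq_bigr => t _.
rewrite scalerA; congr (_ *: _); rewrite /Lexp /sb2 /= ![_ + _%:R]addrC !addrK /sb !ext_nat //.
rewrite /sbin.
transitivity (((-1) ^+ i * (-1) ^+ i) * ((-1) ^+ j * (-1) ^+ j)
  * (binK t.1.1 i * binK t.1.2 j)); last by ring.
by rewrite -!expr2 !sqrr_sign !mul1r.
Qed.

(** Expansions of terms from different cosets of Z^2 have disjoint supports, so the hypothesis holds
    on each coset separately. [ev_coset] settles the coset of the first triple, and the remaining
    list is shorter. *)
Lemma ev_unique0 (l : seq triple) :
  (forall e, ev (Lexp e) l = 0) -> forall L, admissible L -> ev L l = 0.
Proof.
have [m] := ubnP (size l); elim: m l => // m IHm [|t0 l'] lt_m H L HL.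
  by rewrite /ev big_nil.
set l := t0 :: l' in H *.
pose C : pred triple := fun t => `[<same_coset t0.1.2 t.1.2>].
have split_ev M : ev M l = ev M (filter C l) + ev M (filter (predC C) l).
  exact: big_seq_split.
have cosetC x y : same_coset x y -> same_coset y x.
  by move=> [i i']; split; rewrite -opprB; apply: intKN.
have coset_trans x y z : same_coset x y -> same_coset y z -> same_coset x z.
  move=> [i i'] [j j']; split.
    rewrite (_ : _ - _ = z.1 - y.1 - (x.1 - y.1)); last by ring.
    by apply: intKB => //; rewrite -opprB; apply: intKN.
  rewrite (_ : _ - _ = z.2 - y.2 - (x.2 - y.2)); last by ring.
  by apply: intKB => //; rewrite -opprB; apply: intKN.
have H1 e : ev (Lexp e) (filter (predC C) l) = 0.
  have [ce|nce] := pselect (same_coset t0.1.2 e).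
    rewrite /ev big1_seq // => t /andP[_]; rewrite mem_filter => /andP[/= /asboolP nC _].
    rewrite Lexp_out ?scale0r // => c; apply: nC.
    exact: coset_trans ce (cosetC _ _ c).
  have := H e; rewrite split_ev [X in X + _](_ : _ = 0) ?add0r // /ev big1_seq //.
  move=> t /andP[_]; rewrite mem_filter => /andP[/asboolP nC _].
  rewrite Lexp_out ?scale0r // => c; apply: nce; exact: coset_trans nC c.
have H2 e : ev (Lexp e) (filter C l) = 0.
  by have := H e; rewrite split_ev H1 addr0.
rewrite split_ev [X in _ + X]IHm ?addr0 //; last first.
  rewrite /l /= /C asboolT /=; last by split; exists 0; rewrite subrr.
  by rewrite size_filter; exact: leq_ltn_trans (count_size _ _) (lt_m : (size l' < m)%N).
have [|q1 _ Hq1] := @coset_lower_bound t0.1.2 (filter C l).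
  by move=> t; rewrite mem_filter => /andP[/asboolP].
exact: ev_coset Hq1 H2 L HL.
Qed.

Lemma ev_unique (l1 l2 : seq triple) :
  (forall e, ev (Lexp e) l1 = ev (Lexp e) l2) ->
  forall L, admissible L -> ev L l1 = ev L l2.
Proof.
move=> H L HL; apply/eqP; rewrite -subr_eq0 -ev_oppl -ev_cat; apply/eqP.
by apply: ev_unique0 => // e; rewrite ev_cat ev_oppl H subrr.
Qed.

End Independence.

(** * The product and the opposite expansion as functionals *)

Section Functionals.
Variables (K : fieldType) (V : lmodType K).
Hypothesis char0 : [pchar K] =i pred0.

Definition bb2 (s m : K * K) : K := binKK s.1 m.1 * binKK s.2 m.2.

(* The value at [z = w = 1] of [d_z^(-s-1-n)] applied to [z^{D-s-q} w^q]. *)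
Definition Lprod (D n s q : K * K) : K :=
  bb2 (sub2 (sub2 D s) q) (sub2 (sub2 (opp2 s) (one2 K)) n).

(** Pascal's rule: raising [q] lowers the upper entry of a binomial by 1, and raising [s] lowers
    both entries. *)
Lemma admissible_Lprod D n : admissible (Lprod D n).
Proof.
have step (d s q m : K) : binKK (d - s - (q + 1)) (- s - 1 - m)
    = binKK (d - s - q) (- s - 1 - m) - binKK (d - (s + 1) - q) (- (s + 1) - 1 - m).
  rewrite (_ : d - s - q = d - s - (q + 1) + 1); last by ring.
  rewrite (_ : - s - 1 - m = - (s + 1) - 1 - m + 1); last by ring.
  by rewrite binKK_pascal // (_ : d - (s + 1) - q = d - s - (q + 1)) ?addrK //; ring.
rewrite /Lprod /bb2; split=> -[s s'] [q q'] /=; first by rewrite step mulrBl.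
by rewrite step mulrBr.
Qed.

Lemma intr_eq0K (k : int) : ((k%:~R : K) == 0) = (k == 0).
Proof.
case: k => k; first by rewrite natr_eq0.
by rewrite NegzE mulrNz oppr_eq0 natr_eq0.
Qed.

Lemma sgnK_int (k : int) : sgnK (k%:~R : K) = (-1) ^+ odd `|k|%N.
Proof.
rewrite /sgnK; case: asboolP => [[j /eqP]|nk].
  rewrite -subr_eq0 -rmorphB /= intr_eq0K subr_eq0 => /eqP ->.
  by rewrite abszM /= mul2n odd_double.
case: (boolP (odd _)) => // ev; case: nk.
have /dvdnP[j Ej] : (2 %| `|k|)%N by rewrite dvdn2.
case: k Ej {ev} => k /= Ej.
  by exists (Posz j); congr (_%:~R); rewrite Ej PoszM mulrC.
by exists (- Posz j); congr (_%:~R); rewrite NegzE Ej PoszM mulrN mulrC.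
Qed.

Lemma sgnKD (x y : K) : intK x -> intK y -> sgnK (x + y) = sgnK x * sgnK y.
Proof.
move=> [m ->] [n ->]; rewrite -rmorphD /= !sgnK_int -signr_addb.
by congr (_ ^+ _); congr nat_of_bool; lia.
Qed.

Lemma sgnKN (x : K) : intK x -> sgnK (- x) = sgnK x.
Proof. by move=> [m ->]; rewrite -rmorphN !sgnK_int abszN. Qed.

Lemma sgnK_nat n : sgnK (n%:R : K) = (-1) ^+ n.
Proof. by rewrite -[n%:R]/((Posz n)%:~R) sgnK_int /= signr_odd. Qed.

Lemma sgnK1 : sgnK (1 : K) = -1.
Proof. exact: (sgnK_nat 1). Qed.

Lemma sgnK_sqr (x : K) : sgnK x * sgnK x = 1.
Proof. by rewrite /sgnK; case: ifP => _; rewrite ?mulrNN mulr1. Qed.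

(* The coefficient of [w^e] in the expansion of [w^q (z-w)^s] in [|w| > |z|]. *)
Definition Lrev (e s q : K * K) : K :=
  if `[<Kint2 s>] then sgnK (s.1 - s.2) * sb2 s (sub2 (add2 s q) e) else 0.

Lemma intK1 : intK (1 : K). Proof. by exists 1. Qed.

Lemma intKD (x y : K) : intK x -> intK y -> intK (x + y).
Proof. by move=> hx hy; rewrite -[y]opprK; apply/intKB/intKN. Qed.

(** A shift of one coordinate of [s] by 1 respects [Kint2] and reverses [sgnK]; this sign turns
    Pascal's rule for [sb] into admissibility. *)
Lemma admissible_Lrev e : admissible (Lrev e).
Proof.
have i1 := intK1; have iN1 := intKN i1.
split=> -[s s'] [q q']; rewrite /Lrev /Kint2 /=.
  have -> : s + 1 - s' = s - s' + 1 by ring.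
  case: asboolP => [hs|nhs]; last first.
    rewrite asboolF ?subrr // => h; apply: nhs.
    by rewrite -[s - s'](addrK 1); apply: intKB.
  rewrite asboolT; last exact: intKD.
  rewrite [sgnK (s - s' + 1)]sgnKD // sgnK1 /sb2 /=.
  rewrite (_ : s + 1 + q - e.1 = s + q - e.1 + 1); last by ring.
  by rewrite sb_pascal // (_ : s + (q + 1) - e.1 = s + q - e.1 + 1); ring.
have -> : s - (s' + 1) = s - s' - 1 by ring.
case: asboolP => [hs|nhs]; last first.
  rewrite asboolF ?subrr // => h; apply: nhs.
  by rewrite -[s - s'](subrK 1); apply: intKD.
rewrite asboolT; last exact: intKB.
rewrite [sgnK (s - s' - 1)]sgnKD // sgnKN // sgnK1 /sb2 /=.
rewrite (_ : s' + 1 + q' - e.2 = s' + q' - e.2 + 1); last by ring.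
by rewrite sb_pascal // (_ : s' + (q' + 1) - e.2 = s' + q' - e.2 + 1); ring.
Qed.

(* [flip] exchanges the roles of [z] and [w], and so of [Lexp] and [Lrev]. *)
Definition flip (l : seq (triple V)) : seq (triple V) :=
  [seq ((t.1.1, opp2 (add2 t.1.1 t.1.2)), sgnK (t.1.1.1 - t.1.1.2) *: t.2) | t <- l].

Lemma add2C (x y : K * K) : add2 x y = add2 y x.
Proof. by congr pair; rewrite addrC. Qed.

(** The degree [D] enters neither [Lexp] nor [Lrev], so [flip] may take [D = 0]; the exponents of
    [z] and [w] are then opposite to each other. *)
Lemma ev_Lexp_flip e (l : seq (triple V)) : (forall t, t \in l -> Kint2 t.1.1) ->
  ev (Lexp e) (flip l) = ev (Lrev (opp2 e)) l.
Proof.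
move=> hl; rewrite ev_map /ev; apply: eq_big_seq => t /hl ht /=.
rewrite scalerA /Lrev asboolT // mulrC /Lexp; congr ((_ * sb2 _ _) *: _).
by rewrite /sub2 /opp2 /add2 /=; congr pair; ring.
Qed.

Lemma ev_Lrev_flip e (l : seq (triple V)) : (forall t, t \in l -> Kint2 t.1.1) ->
  ev (Lrev (opp2 e)) (flip l) = ev (Lexp e) l.
Proof.
move=> hl; rewrite ev_map /ev; apply: eq_big_seq => t /hl ht /=.
rewrite scalerA /Lrev asboolT // mulrAC sgnK_sqr mul1r /Lexp; congr (sb2 _ _ *: _).
by rewrite /sub2 /opp2 /add2 /=; congr pair; ring.
Qed.

(** [flip] turns the hypothesis into an equality of ordinary expansions; [ev_unique] for the
    functional [Lrev] then returns [Lexp] of the original lists. *)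
Lemma ev_unique_rev (l1 l2 : seq (triple V)) :
  (forall t, t \in l1 -> Kint2 t.1.1) -> (forall t, t \in l2 -> Kint2 t.1.1) ->
  (forall e, ev (Lrev e) l1 = ev (Lrev e) l2) ->
  forall e, ev (Lexp e) l1 = ev (Lexp e) l2.
Proof.
move=> h1 h2 H e; rewrite -!ev_Lrev_flip //; apply: ev_unique => //.
  by move=> e'; rewrite !ev_Lexp_flip.
exact: admissible_Lrev.
Qed.

End Functionals.

(** * Interchange of finitely supported sums *)

Section FiniteSums.
Variables (K : fieldType) (V : lmodType K).

Lemma fsum_seq (W : zmodType) (T : choiceType) (s : seq T) (F : T -> W) : uniq s ->
  (forall k, F k != 0 -> k \in s) -> \sum_(k \in [set: T]) F k = \sum_(k <- s) F k.
Proof.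
move=> us Fs; rewrite (fsbigE s) //.
  by apply: eq_bigl => k; rewrite in_setT.
by move=> k _; apply: contraNeq; apply: Fs.
Qed.

(** A sum of infinite support is 0 by default, so the exchange requires for each [m] a finite list
    [s m] that contains the support of the coefficients. *)
Lemma fsum_exchange (T I : choiceType) (S : seq I) (c : T -> I -> K) (v : I -> V)
    (s : I -> seq T) :
  (forall m, uniq (s m)) -> (forall m k, m \in S -> c k m != 0 -> k \in s m) ->
  \sum_(k \in [set: T]) (\sum_(m <- S) c k m *: v m)
  = \sum_(m <- S) (\sum_(k <- s m) c k m) *: v m.
Proof.
move=> us cs; set A := undup (flatten [seq s m | m <- S]).
rewrite (@fsum_seq _ _ A) ?undup_uniq //; last first.
  move=> k; apply: contra_neqT => kA; rewrite big1_seq // => m /andP[_ mS].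
  have [->|/(cs _ _ mS) ks] := eqVneq (c k m) 0; first by rewrite scale0r.
  by case/negP: kA; rewrite mem_undup; apply/flatten_mapP; exists m.
rewrite exchange_big /=; apply: eq_big_seq => m mS.
rewrite -scaler_suml; congr (_ *: _).
rewrite (bigID (mem (s m))) /= [X in _ + X]big1 ?addr0; last first.
  by move=> k ks; apply: contraNeq ks; apply: cs.
rewrite -big_filter; apply: perm_big; apply: uniq_perm => //.
  by rewrite filter_uniq ?undup_uniq.
move=> k; rewrite mem_filter /= mem_undup; apply/andP/idP => [[]//|ks]; split=> //.
by apply/flatten_mapP; exists m.
Qed.

Lemma fsum_single (T I : choiceType) (S : seq I) (c : T -> I -> K) (v : I -> V)
    (kap : I -> T) :
  (forall m k, m \in S -> c k m != 0 -> k = kap m) ->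
  \sum_(k \in [set: T]) (\sum_(m <- S) c k m *: v m)
  = \sum_(m <- S) c (kap m) m *: v m.
Proof.
move=> H; rewrite (@fsum_exchange _ _ _ _ _ (fun m => [:: kap m])) //; last first.
  by move=> m k mS /(H m k mS) ->; rewrite mem_head.
by apply: eq_bigr => m _; rewrite big_seq1.
Qed.

End FiniteSums.

(** * Series in two variables *)

Section SeriesLists.
Variables (K : fieldType) (V : lmodType K).
Hypothesis char0 : [pchar K] =i pred0.

Definition totdeg r (e : expo K r) : K * K := (\sum_i (e i).1, \sum_i (e i).2).

(** The exponents of a power series are natural, so their sum bounds each of them. A monomial factor
    [m j] only shifts the degree, and [f] is a finite sum of such shifted series. *)
Lemma finite_homogeneous_support r (f : ser K V r) (D : K * K) : in_lser f ->
  finite_set [set e : expo K r | totdeg e = D /\ f e != 0].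
Proof.
case=> N [m [g [hg ->]]].
pose Bd (j : 'I_N) : nat * nat :=
  (natof (D.1 - (totdeg (m j)).1), natof (D.2 - (totdeg (m j)).2)).
pose F (j : 'I_N) (k : {ffun 'I_r -> 'I_(Bd j).1.+1 * 'I_(Bd j).2.+1}) : expo K r :=
  fun i => add2 (m j i) ((nat_of_ord (k i).1)%:R, (nat_of_ord (k i).2)%:R).
apply: (@sub_finite_set _ _ (\bigcup_(j in [set: 'I_N]) [set F j k | k in setT])).
  move=> e [eD ne].
  have [j gj] : exists j, g j (fun l => sub2 (e l) (m j l)) != 0.
    apply: contrapT => nj; case/eqP: ne; apply: big1 => j _.
    by apply/eqP; apply: contrapT => /negP gj; apply: nj; exists j.
  exists j => //; have hk := hg j _ gj.
  have k1 i : (e i).1 - (m j i).1 = (natof ((e i).1 - (m j i).1))%:R.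
    by apply: natofE; case: (hk i).
  have k2 i : (e i).2 - (m j i).2 = (natof ((e i).2 - (m j i).2))%:R.
    by apply: natofE; case: (hk i).
  have b1 i : (natof ((e i).1 - (m j i).1) < (Bd j).1.+1)%N.
    rewrite /= -eD /totdeg /= -sumrB (eq_bigr _ (fun l _ => k1 l)).
    by rewrite -natr_sum natof_nat // ltnS (bigD1 i) //= leq_addr.
  have b2 i : (natof ((e i).2 - (m j i).2) < (Bd j).2.+1)%N.
    rewrite /= -eD /totdeg /= -sumrB (eq_bigr _ (fun l _ => k2 l)).
    by rewrite -natr_sum natof_nat // ltnS (bigD1 i) //= leq_addr.
  exists [ffun i => (Ordinal (b1 i), Ordinal (b2 i))] => //.
  apply/funext => i; rewrite /F ffunE /add2 /= -k1 -k2 !subrKC; by case: (e i).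
by apply: bigcup_finite => // j _; apply: finite_image.
Qed.

Lemma homogeneous_monomials r (f : ser K V r) (D : K * K) : in_lser f ->
  exists S : seq (expo K r), (forall m, m \in S -> totdeg m = D) /\
    forall e, totdeg e = D -> f e = \sum_(m <- S) (e == m)%:R *: f m.
Proof.
move=> /(finite_homogeneous_support D) /finite_seqP[s Es].
have in_s e : (e \in s) <-> totdeg e = D /\ f e != 0.
  by have /seteqP[h1 h2] := Es; split=> [/h2|/h1].
exists (undup s); split=> [m|e eD]; first by rewrite mem_undup => /in_s[].
have [fe0|fe] := eqVneq (f e) 0.
  rewrite fe0 big1_seq // => m /andP[_]; rewrite mem_undup => /in_s[_ fm].
  by case: eqP => [em|_]; rewrite ?scale0r // -em fe0 scaler0.
rewrite (bigD1_seq e) ?undup_uniq ?mem_undup //=; last exact/in_s.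
rewrite eqxx scale1r big1 ?addr0 // => m; rewrite eq_sym => /negPf ->.
by rewrite scale0r.
Qed.

Lemma add2A (x y z : K * K) : add2 x (add2 y z) = add2 (add2 x y) z.
Proof. by rewrite /add2 /= !addrA. Qed.

Lemma totdeg_upd r (e : expo K r) i x : totdeg (upd e i x) = add2 (totdeg e) x.
Proof.
rewrite /totdeg /upd /add2 /=; congr pair; rewrite (bigD1 i) //= eqxx /=;
rewrite [in RHS](bigD1 i) //= addrAC; congr (_ + _ + _); apply: eq_bigr => l /negPf ->;
by [].
Qed.

Lemma nat2KE (x y : K * K) k : (sub2 x (nat2K K k) == y) ->
  k = (natof (x.1 - y.1), natof (x.2 - y.2)).
Proof.
case: k => k k' /eqP <-; rewrite /sub2 /add2 /opp2 /nat2K /=.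
by congr pair; rewrite opprB subrKC natof_nat.
Qed.

(** If [x - y] is not in N^2, the default values of [natof] do no harm: equality in the Kronecker
    symbol would make [x - y] natural. *)
Lemma sb2_delta (n x y : K * K) :
  let k := (natof (x.1 - y.1), natof (x.2 - y.2)) in
  sbin n.1 k.1 * sbin n.2 k.2 * (sub2 x (nat2K K k) == y)%:R = sb2 n (sub2 x y).
Proof.
rewrite /= /sb2 /sb /=.
have [/natofE h1|h1] := pselect (natK (x.1 - y.1)); last first.
  rewrite [ext _ (x.1 - y.1)]ext_out // mul0r; case: eqP => [E|_]; last by rewrite mulr0.
  case: h1; exists (natof (x.1 - y.1)).
  by rewrite -{1}E /sub2 /add2 /=; ring.
have [/natofE h2|h2] := pselect (natK (x.2 - y.2)); last first.
  rewrite [ext _ (x.2 - y.2)]ext_out // mulr0; case: eqP => [E|_]; last by rewrite mulr0.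
  case: h2; exists (natof (x.2 - y.2)).
  by rewrite -{1}E /sub2 /add2 /=; ring.
rewrite {3}h1 {3}h2 !ext_nat //.
rewrite (_ : sub2 _ _ = y) ?eqxx ?mulr1 // /sub2 /add2 /opp2 /nat2K /= -h1 -h2.
by rewrite !opprB !subrKC; case: (y).
Qed.

Lemma sbin_sign (x y : K) (k k' : nat) :
  (-1) ^+ (k + k') * binK x k * binK y k' = sbin x k * sbin y k'.
Proof. by rewrite /sbin exprD; ring. Qed.

(* Multiplying the monomials [w^(q m)] by [(z-w)^n]. *)
Lemma mulpow_monomials r (i j : 'I_r) n (g : ser K V r) e (I : choiceType) (S : seq I)
    (q : I -> K * K) (psi : I -> K) (v : I -> V) :
  (forall k, g (upd (upd e i (opp2 (sub2 n (nat2K K k)))) j (opp2 (nat2K K k)))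
     = \sum_(m <- S) ((sub2 (e j) (nat2K K k) == q m)%:R * psi m) *: v m) ->
  mulpow i j n g e = \sum_(m <- S) (sb2 n (sub2 (e j) (q m)) * psi m) *: v m.
Proof.
move=> Hg; rewrite /mulpow.
under eq_fsbigr => k _ do rewrite Hg sbin_sign scaler_sumr.
pose c (k : nat * nat) m := sbin n.1 k.1 * sbin n.2 k.2 *
   ((sub2 (e j) (nat2K K k) == q m)%:R * psi m).
rewrite (eq_fsbigr (fun k => \sum_(m <- S) c k m *: v m)); last first.
  by move=> k _; apply: eq_bigr => m _; rewrite scalerA.
rewrite (fsum_single _ (kap := fun m =>
  (natof ((e j).1 - (q m).1), natof ((e j).2 - (q m).2)))).
  by apply: eq_bigr => m _; rewrite /c mulrA sb2_delta.
move=> m k _; rewrite /c; case: (boolP (_ == q m)) => [/nat2KE//|_].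
by rewrite mul0r mulr0 eqxx.
Qed.

Lemma ord2_case (P : 'I_2 -> Prop) : P z0 -> P z1 -> forall i, P i.
Proof.
move=> h0 h1 [[|[|//]] hi].
  by rewrite (_ : Ordinal hi = z0) //; apply/val_inj.
by rewrite (_ : Ordinal hi = z1) //; apply/val_inj.
Qed.

Lemma expo2_eq (e e' : expo K 2) : totdeg e = totdeg e' ->
  (e == e') = (e z1 == e' z1).
Proof.
rewrite /totdeg !big_ord_recl !big_ord0 !addr0 => -[]; rewrite -[ord0]/z0.
rewrite (_ : lift _ _ = z1); last exact/val_inj.
move=> E1 E2; apply/eqP/eqP => [->//|E]; apply/funext; apply: ord2_case => //.
rewrite [e z0]surjective_pairing [e' z0]surjective_pairing.
by congr pair; [apply: (addIr (e z1).1)|apply: (addIr (e z1).2)]; rewrite ?E1 ?E2 E.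
Qed.

Lemma expo2_eq0 (e e' : expo K 2) : totdeg e = totdeg e' ->
  (e == e') = (e z0 == e' z0).
Proof.
rewrite /totdeg !big_ord_recl !big_ord0 !addr0 => -[]; rewrite -[ord0]/z0.
rewrite (_ : lift _ _ = z1); last exact/val_inj.
move=> E1 E2; apply/eqP/eqP => [->//|E]; apply/funext; apply: ord2_case => //.
rewrite [e z1]surjective_pairing [e' z1]surjective_pairing.
by congr pair; [apply: (addrI (e z0).1)|apply: (addrI (e z0).2)]; rewrite ?E1 ?E2 E.
Qed.

Definition mk2 (x y : K * K) : expo K 2 := fun l => if l == z0 then x else y.

Lemma totdeg_mk2 x y : totdeg (mk2 x y) = add2 x y.
Proof. by rewrite /totdeg !big_ord_recl !big_ord0 !addr0. Qed.

(** A single list must serve both expansions and the product, since uniqueness carries information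
    from one to the others. Its entries are the monomials of [f] in degree [D - n]. *)
Lemma pair_list (f : ser K V 2) n D : in_lser f ->
  exists l : seq (triple V), [/\ forall t, t \in l -> t.1.1 = n,
    forall e, totdeg e = D -> mulpow z0 z1 n f e = ev (Lexp (e z1)) l,
    Kint2 n -> forall e, totdeg e = D -> mulpow_rev z0 z1 n f e = ev (Lrev (e z1)) l &
    forall np x, D = sub2 (sub2 x (one2 K)) np ->
      let m := sub2 (sub2 (opp2 n) (one2 K)) np in
      \sum_(u \in [set: K * K]) (binKK (u.1 + m.1) m.1 * binKK (u.2 + m.2) m.2)
          *: f (fun l => if l == z0 then add2 u m else sub2 x u)
      = ev (Lprod D np) l].
Proof.
move=> hf; have [S [St Sf]] := homogeneous_monomials (sub2 D n) hf.
exists [seq ((n, m z1), f m) | m <- S]; split.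
- by move=> t /mapP[m _ ->].
- move=> e eD; rewrite ev_map /=.
  rewrite (mulpow_monomials (S := S) (q := fun m => m z1) (psi := fun=> 1) (v := f)).
    by apply: eq_bigr => m _; rewrite mulr1.
  move=> k; rewrite Sf.
    apply: eq_big_seq => m mS; rewrite mulr1 expo2_eq //; last first.
      rewrite !totdeg_upd (St m mS) eD /sub2 /add2 /opp2 /=; congr pair; ring.
  rewrite !totdeg_upd eD /sub2 /add2 /opp2 /=; congr pair; ring.
- move=> hn e eD; rewrite ev_map /= /mulpow_rev.
  rewrite (mulpow_monomials (S := S) (q := fun m => m z0) (psi := fun=> 1) (v := f)).
    rewrite scaler_sumr; apply: eq_big_seq => m mS; rewrite mulr1 scalerA /Lrev asboolT //.
    congr ((_ * sb2 _ _) *: _).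
    (* [Lrev] is expressed through the exponents of [w]; the fixed degree converts those of [z] into
       them. *)
    have := St m mS; rewrite -eD /totdeg !big_ord_recl !big_ord0 !addr0.
    rewrite -[ord0]/z0 (_ : lift _ _ = z1); last exact/val_inj.
    rewrite /sub2 /add2 /opp2 /= => -[E1 E2].
    rewrite -[X in (X - (m z0).1, _)](addrK (e z1).1) -[X in (_, X - (m z0).2)](addrK (e z1).2).
    rewrite -[X in (X - (e z1).1 - _, _)](subrK n.1) -E1.
    rewrite -[X in (_, X - (e z1).2 - _)](subrK n.2) -E2; congr pair; ring.
  move=> k; rewrite Sf.
    apply: eq_big_seq => m mS; rewrite mulr1 expo2_eq0 //; last first.
      rewrite !totdeg_upd (St m mS) eD /sub2 /add2 /opp2 /=; congr pair; ring.
  rewrite !totdeg_upd eD /sub2 /add2 /opp2 /=; congr pair; ring.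
- move=> np x Dx m; rewrite ev_map /=.
  have tot u : totdeg (fun l : 'I_2 => if l == z0 then add2 u m else sub2 x u) = sub2 D n.
    rewrite (totdeg_mk2 (add2 u m) (sub2 x u)) /m Dx /sub2 /add2 /opp2 /one2 /=; congr pair; ring.
  under eq_fsbigr => u _ do rewrite Sf // scaler_sumr.
  pose c (u : K * K) (p : expo K 2) := (binKK (u.1 + m.1) m.1 * binKK (u.2 + m.2) m.2)
     * (sub2 x u == p z1)%:R.
  rewrite (eq_fsbigr (fun u => \sum_(p <- S) c u p *: f p)); last first.
    by move=> u _; apply: eq_big_seq => p pS; rewrite scalerA /c expo2_eq ?tot ?St.
  (* The monomial [p] contributes only where [x - u] is its exponent of [w]. *)
  rewrite (fsum_single _ (kap := fun p => sub2 x (p z1))).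
    apply: eq_bigr => p _; congr (_ *: _); rewrite /c.
    rewrite (_ : sub2 x (sub2 x (p z1)) = p z1); last first.
      by rewrite /sub2 /add2 /opp2 /= !opprB !subrKC; case: (p z1).
    rewrite eqxx mulr1 /Lprod /bb2 -/m Dx /=; congr (binKK _ _ * binKK _ _);
    rewrite /m /=; ring.
  move=> p u _; rewrite /c; case: (boolP (_ == p z1)) => [/eqP <- _|_].
    by rewrite /sub2 /add2 /opp2 /= !opprB !subrKC; case: (u).
  by rewrite mulr0 eqxx.
Qed.

End SeriesLists.

(** * Finite ranges of exponents and the Leibniz rule over K *)

Section Boxes.
Variable K : fieldType.
Hypothesis char0 : [pchar K] =i pred0.

Definition pairs (s t : seq nat) : seq (nat * nat) := [seq (k, k') | k <- s, k' <- t].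

Lemma sum_pairs (s t : seq nat) (F G : nat -> K) :
  \sum_(k <- pairs s t) F k.1 * G k.2 = (\sum_(k <- s) F k) * (\sum_(k <- t) G k).
Proof.
rewrite big_allpairs_dep /= mulr_suml; apply: eq_bigr => k _.
by rewrite mulr_sumr.
Qed.

(** For [x] outside N this is the range [[:: 0]], whereas [upto_if] is then empty. *)
Definition upto (x : K) : seq nat := iota 0 (natof x).+1.
Definition upto_if (x : K) : seq nat := if `[<natK x>] then upto x else [::].
Definition box (x : K * K) := pairs (upto x.1) (upto x.2).
Definition box_if (x : K * K) := pairs (upto_if x.1) (upto_if x.2).

Lemma pairs_iota_uniq A B : uniq (pairs (iota 0 A) (iota 0 B)).
Proof. by apply: allpairs_uniq; rewrite ?iota_uniq // => -[? ?] [? ?]. Qed.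

Lemma mem_pairs_iota A B k :
  (k \in pairs (iota 0 A) (iota 0 B)) = (k.1 < A)%N && (k.2 < B)%N.
Proof.
case: k => k k'; apply/allpairsP/idP => /= [[[a b] /= []]|/andP[h1 h2]].
  by rewrite !mem_iota /= !add0n => h1 h2 [-> ->]; rewrite h1.
by exists (k, k'); rewrite !mem_iota /= !add0n.
Qed.

Lemma natK_le (x : K) (k : nat) : natK (x - k%:R) -> natK x /\ (k <= natof x)%N.
Proof.
case=> n E; have -> : x = (n + k)%:R by rewrite natrD -E subrK.
by rewrite natof_nat // leq_addl; split=> //; exists (n + k)%N.
Qed.

Lemma box_mem (x : K * K) k :
  natK (x.1 - k.1%:R) -> natK (x.2 - k.2%:R) -> k \in box x.
Proof. by move=> /natK_le[_ h1] /natK_le[_ h2]; rewrite mem_pairs_iota !ltnS h1. Qed.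

Lemma sum_upto_nat (n : nat) (F : nat -> K) :
  \sum_(k <- upto n%:R) F k = \sum_(k < n.+1) F k.
Proof.
by rewrite /upto natof_nat // -[iota _ _]/(index_iota 0 n.+1) big_mkord.
Qed.

(** For natural [M] and [E] this is [leibniz_expand]. Otherwise both sides vanish: for [M] because
    of [binKK] and the empty range, for [E] because of [sb]. *)
Lemma leibniz_ext (x y p M E : K) :
  \sum_(k <- upto E) sbin y k * sb x (E - k%:R) * binKK (p + x - (E - k%:R)) M
  = \sum_(j <- upto_if M) binK p (natof M - j) * binK x j * sb (x + y - j%:R) E.
Proof.
rewrite /upto_if; case: asboolP => [[m ->]|nM]; last first.
  rewrite big_nil big1 // => k _; rewrite binKKE // [ext _ M]ext_out // mulr0 //.
have [[n ->]|nE] := pselect (natK E); last first.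
  rewrite !big1 // => k _; first by rewrite /sb ext_out ?mulr0.
  by rewrite /sb ext_out ?mulr0 ?mul0r // => /natK_le[].
rewrite !sum_upto_nat natof_nat // /sb.
transitivity (\sum_(k < n.+1) sbin y k * sbin x (n - k) * binK (p + x - (n - k)%:R) m).
  apply: eq_bigr => k _; have kn : (k <= n)%N by rewrite -ltnS.
  by rewrite -natrB // binKKE // !ext_nat.
by rewrite leibniz_expand //; apply: eq_bigr => j _; rewrite ext_nat.
Qed.

Lemma leibniz_ext_rev (x y p M E : K) :
  \sum_(k <- upto E) sbin y k * sb x (E - k%:R) * binKK (p + (E - k%:R)) M
  = \sum_(j <- upto_if M)
      binK p (natof M - j) * binK x j * ((-1) ^+ j * sb (x + y - j%:R) (E - j%:R)).
Proof.
rewrite /upto_if; case: asboolP => [[m ->]|nM]; last first.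
  rewrite big_nil big1 // => k _; rewrite binKKE // [ext _ M]ext_out // mulr0 //.
have [[n ->]|nE] := pselect (natK E); last first.
  rewrite !big1 // => k _.
    by rewrite /sb ext_out ?mulr0 // => /natK_le[].
  by rewrite /sb ext_out ?mulr0 ?mul0r // => /natK_le[].
rewrite !sum_upto_nat natof_nat // /sb.
transitivity (\sum_(k < n.+1) sbin y k * sbin x (n - k) * binK (p + (n - k)%:R) m).
  apply: eq_bigr => k _; have kn : (k <= n)%N by rewrite -ltnS.
  by rewrite -natrB // binKKE // !ext_nat.
rewrite leibniz_expand_rev //; apply: eq_bigr => j _; congr (_ * (_ * _)).
case: leqP => [jn|nj]; first by rewrite -natrB // ext_nat.
rewrite ext_out // => /natK_le[_]; rewrite natof_nat // => jn.
by rewrite ltnNge jn in nj.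
Qed.

End Boxes.

Definition i0 : 'I_3 := @Ordinal 3 0 isT.
Definition i1 : 'I_3 := @Ordinal 3 1 isT.
Definition i2 : 'I_3 := @Ordinal 3 2 isT.

Lemma enum3 : enum 'I_3 = [:: i0; i1; i2].
Proof. by apply: (inj_map val_inj); rewrite val_enum_ord. Qed.

Lemma ord3_case (P : 'I_3 -> Prop) : P i0 -> P i1 -> P i2 -> forall i, P i.
Proof.
move=> h0 h1 h2 [[|[|[|//]]] hi].
- by rewrite (_ : Ordinal hi = i0) //; apply/val_inj.
- by rewrite (_ : Ordinal hi = i1) //; apply/val_inj.
- by rewrite (_ : Ordinal hi = i2) //; apply/val_inj.
Qed.

(* The order [(x, a, b)] of the family [(a, b, x)]. *)
Definition rot3 : {perm 'I_3} := perm (@ord_pred_inj 3).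

Lemma rot3E : (rot3 i0 = i2) * (rot3 i1 = i0) * (rot3 i2 = i1).
Proof. by rewrite !permE; split; [split|]; apply/val_inj. Qed.

Lemma rot3VE : ((rot3^-1)%g i0 = i1) * ((rot3^-1)%g i1 = i2) * ((rot3^-1)%g i2 = i0).
Proof.
by split; [split|]; apply: (@perm_inj _ rot3); rewrite permKV rot3E.
Qed.

(** * Series in three variables *)

Section ThreeVariables.
Variables (K : fieldType) (V : lmodType K).
Hypothesis char0 : [pchar K] =i pred0.

Lemma mulprod_id3 (H : 'I_3 -> 'I_3 -> K * K) (f : ser K V 3) :
  mulprod_s 1%g H f = mulpow i1 i2 (opp2 (H i1 i2))
    (mulpow i0 i2 (opp2 (H i0 i2)) (mulpow i0 i1 (opp2 (H i0 i1)) f)).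
Proof. by rewrite /mulprod_s enum3 /= /mulpow_s !perm1 invg1 !perm1. Qed.

Lemma mulprod_rot3 (H : 'I_3 -> 'I_3 -> K * K) (f : ser K V 3) :
  mulprod_s rot3 H f = mulpow i0 i1 (opp2 (H i0 i1))
    (mulpow_rev i1 i2 (opp2 (H i1 i2)) (mulpow_rev i0 i2 (opp2 (H i0 i2)) f)).
Proof. by rewrite /mulprod_s enum3 /= /mulpow_s !rot3E !rot3VE. Qed.

Lemma totdeg3 (e : expo K 3) : totdeg e = add2 (e i0) (add2 (e i1) (e i2)).
Proof.
rewrite /totdeg !big_ord_recl !big_ord0 !addr0 /add2 /=.
rewrite (_ : lift ord0 ord0 = i1); last exact/val_inj.
rewrite (_ : lift ord0 (lift ord0 ord0) = i2); last exact/val_inj.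
by rewrite (_ : ord0 = i0); last exact/val_inj.
Qed.

Lemma add2I (x : K * K) : injective (add2 x).
Proof. by move=> [y y'] [z z'] [/addrI -> /addrI ->]. Qed.

Lemma expo3_eq12 (e m : expo K 3) : totdeg e = totdeg m ->
  (e == m) = (e i1 == m i1) && (e i2 == m i2).
Proof.
rewrite !totdeg3 => E; apply/eqP/andP => [->//|[/eqP E1 /eqP E2]].
apply/funext; apply: ord3_case => //.
by apply: (@add2I (add2 (m i1) (m i2))); rewrite ![add2 (add2 _ _) _]add2C -E E1 E2.
Qed.

Lemma expo3_eq01 (e m : expo K 3) : totdeg e = totdeg m ->
  (e == m) = (e i0 == m i0) && (e i1 == m i1).
Proof.
rewrite !totdeg3 => E; apply/eqP/andP => [->//|[/eqP E1 /eqP E2]].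
apply/funext; apply: ord3_case => //.
by apply: (@add2I (add2 (m i0) (m i1))); rewrite -!add2A -E E1 E2.
Qed.

Definition sbin2 (n : K * K) (k : nat * nat) : K := sbin n.1 k.1 * sbin n.2 k.2.

Lemma sb2_nat (n : K * K) k : sb2 n (nat2K K k) = sbin2 n k.
Proof. by rewrite /sb2 /sb /= !ext_nat. Qed.

Lemma sb2_neq0 (n m : K * K) : sb2 n m != 0 -> natK m.1 /\ natK m.2.
Proof.
rewrite /sb2 /sb => h; split; apply: contrapT => nk; case/eqP: h.
  by rewrite ext_out // mul0r.
by rewrite mulrC ext_out // mul0r.
Qed.

Variables (f : ser K V 3) (S : seq (expo K 3)) (D n12 n13 n23 : K * K).
Hypothesis St : forall m, m \in S -> totdeg m = sub2 (sub2 (sub2 D n12) n13) n23.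
Hypothesis Sf : forall e, totdeg e = sub2 (sub2 (sub2 D n12) n13) n23 ->
  f e = \sum_(m <- S) (e == m)%:R *: f m.

Ltac pair_ring := rewrite /sub2 /add2 /opp2 /nat2K /=; congr pair; ring.

(** With [z], [w], [u] for the three variables, this is the coefficient of [u^e2] as a series in
    [z], [w]: the factor [(w-u)^n23] supplies [u^k], and [(z-u)^n13] the remaining power
    [e2 - m i2 - k]. *)
Definition list_id (e2 : K * K) : seq (triple V) :=
  [seq ((n12, sub2 (add2 (m i1) n23) (nat2K K k)),
     (sbin2 n23 k * sb2 n13 (sub2 (sub2 e2 (m i2)) (nat2K K k))) *: f m)
  | m <- S, k <- box (sub2 e2 (m i2))].

Lemma mulpow_id3 e : totdeg e = D ->
  mulpow i1 i2 n23 (mulpow i0 i2 n13 (mulpow i0 i1 n12 f)) e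
  = ev (Lexp (e i1)) (list_id (e i2)).
Proof.
move=> eD.
have step1 e' : totdeg e' = sub2 (sub2 D n13) n23 ->
    mulpow i0 i1 n12 f e' = \sum_(m <- S)
       (sb2 n12 (sub2 (e' i1) (m i1)) * (e' i2 == m i2)%:R) *: f m.
  move=> e'D; apply: mulpow_monomials => // k; rewrite Sf; last first.
    by rewrite !totdeg_upd e'D; pair_ring.
  apply: eq_big_seq => m mS; rewrite expo3_eq12; last first.
    by rewrite !totdeg_upd e'D (St mS); pair_ring.
  by rewrite /upd /= -natrM mulnb.
have step2 e' : totdeg e' = sub2 D n23 ->
    mulpow i0 i2 n13 (mulpow i0 i1 n12 f) e' = \sum_(m <- S)
       (sb2 n13 (sub2 (e' i2) (m i2)) * sb2 n12 (sub2 (e' i1) (m i1))) *: f m.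
  move=> e'D; apply: mulpow_monomials => // k; rewrite step1; last first.
    by rewrite !totdeg_upd e'D; pair_ring.
  by apply: eq_bigr => m _; rewrite /upd /= mulrC.
rewrite /mulpow.
pose c (k : nat * nat) (m : expo K 3) := sbin2 n23 k *
  (sb2 n13 (sub2 (sub2 (e i2) (m i2)) (nat2K K k)) *
   sb2 n12 (sub2 (e i1) (sub2 (add2 (m i1) n23) (nat2K K k)))).
rewrite (eq_fsbigr (fun k => \sum_(m <- S) c k m *: f m)); last first.
  move=> k _; rewrite sbin_sign -/(mulpow i0 i1 n12 f).
  rewrite -[X in _ *: X]/(mulpow i0 i2 n13 (mulpow i0 i1 n12 f) _) step2; last first.
    by rewrite !totdeg_upd eD; pair_ring.
  rewrite scaler_sumr; apply: eq_bigr => m _; rewrite scalerA /upd /= /c.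
  congr ((_ * (sb2 _ _ * sb2 _ _)) *: _); pair_ring.
(* The power of [u] left for [(z-u)^n13] must be natural, which confines [k] to a box. *)
rewrite (fsum_exchange _ (s := fun m => box (sub2 (e i2) (m i2)))); first last.
- move=> m k _ ck.
  have /sb2_neq0[h1 h2] : sb2 n13 (sub2 (sub2 (e i2) (m i2)) (nat2K K k)) != 0.
    by apply: contraNneq ck => E; rewrite /c E mul0r mulr0.
  exact: box_mem.
- by move=> m; apply: pairs_iota_uniq.
rewrite /ev /list_id big_allpairs_dep /=; apply: eq_bigr => m _.
by rewrite scaler_suml; apply: eq_bigr => k _; rewrite scalerA /c /Lexp; congr (_ *: _); ring.
Qed.

(** The total power of [z] and [w] that [(u-z)^n13 (u-w)^n23] contributes when [u] carries the
    exponent [e2]. *)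
Definition revdeg (m : expo K 3) (e2 : K * K) : K * K :=
  sub2 (add2 (m i2) (add2 n13 n23)) e2.

Definition sgn2 (n : K * K) : K := sgnK (n.1 - n.2).

Definition list_rot (e2 : K * K) : seq (triple V) :=
  [seq ((n12, add2 (m i1) (nat2K K k)),
     (sgn2 n13 * sgn2 n23 * (sbin2 n23 k * sb2 n13 (sub2 (revdeg m e2) (nat2K K k)))) *: f m)
  | m <- S, k <- box (revdeg m e2)].

(** The factor [(z-w)^n12] comes last here. Before it, the series with [e i2] fixed is rewritten as
    a finite list of monomials in [w], to which [mulpow_monomials] applies. *)
Lemma mulpow_rot3 e : totdeg e = D ->
  mulpow i0 i1 n12 (mulpow_rev i1 i2 n23 (mulpow_rev i0 i2 n13 f)) e
  = ev (Lexp (e i1)) (list_rot (e i2)).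
Proof.
move=> eD.
have step1 e' : totdeg e' = sub2 (sub2 D n12) n23 ->
    mulpow_rev i0 i2 n13 f e' = \sum_(m <- S)
       (sgn2 n13 * sb2 n13 (sub2 (e' i0) (m i0)) * (e' i1 == m i1)%:R) *: f m.
  move=> e'D; rewrite /mulpow_rev.
  rewrite (mulpow_monomials _ (S := S) (q := fun m => m i0)
     (psi := fun m => (e' i1 == m i1)%:R) (v := f)) //.
    by rewrite scaler_sumr; apply: eq_bigr => m _; rewrite scalerA mulrA.
  move=> k; rewrite Sf; last by rewrite !totdeg_upd e'D; pair_ring.
  apply: eq_big_seq => m mS; rewrite expo3_eq01; last first.
    by rewrite !totdeg_upd e'D (St mS); pair_ring.
  by rewrite /upd /= -natrM mulnb.
have step2 e' : totdeg e' = sub2 D n12 ->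
    mulpow_rev i1 i2 n23 (mulpow_rev i0 i2 n13 f) e' = \sum_(m <- S)
       (sgn2 n13 * sgn2 n23 *
          (sb2 n23 (sub2 (e' i1) (m i1)) * sb2 n13 (sub2 (e' i0) (m i0)))) *: f m.
  move=> e'D; rewrite {1}/mulpow_rev.
  rewrite (mulpow_monomials _ (S := S) (q := fun m => m i1)
     (psi := fun m => sgn2 n13 * sb2 n13 (sub2 (e' i0) (m i0))) (v := f)) //.
    rewrite scaler_sumr; apply: eq_bigr => m _; rewrite scalerA /sgn2; congr (_ *: _); ring.
  move=> k; rewrite step1; last by rewrite !totdeg_upd e'D; pair_ring.
  by apply: eq_bigr => m _; rewrite /upd /= mulrC.
pose S' := [seq (m, k) | m <- S, k <- box (revdeg m (e i2))].
pose psi (t : expo K 3 * (nat * nat)) := sgn2 n13 * sgn2 n23 *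
   (sbin2 n23 t.2 * sb2 n13 (sub2 (revdeg t.1 (e i2)) (nat2K K t.2))).
rewrite (mulpow_monomials _ (S := S') (q := fun t => add2 (t.1 i1) (nat2K K t.2))
     (psi := psi) (v := fun t => f t.1)) //.
  rewrite /ev /list_rot /S' !big_allpairs_dep /=; apply: eq_bigr => m _.
  by apply: eq_bigr => k _; rewrite scalerA /psi /Lexp.
move=> k; set e' := upd _ _ _.
have e'D : totdeg e' = sub2 D n12 by rewrite !totdeg_upd eD; pair_ring.
have e'1 : e' i1 = sub2 (e i1) (nat2K K k) by rewrite /e' /upd /=; pair_ring.
have e'2 : e' i2 = e i2 by [].
clearbody e'.
rewrite step2 // /S' big_allpairs_dep /=; apply: eq_big_seq => m mS.
(* The total degree fixes the power of [z] taken from [(u-z)^n13]. *)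
have e'0 : sub2 (e' i0) (m i0) = sub2 (revdeg m (e i2)) (sub2 (e' i1) (m i1)).
  have := St mS; have := e'D; rewrite !totdeg3 /revdeg.
  rewrite e'2 /sub2 /add2 /opp2 /= => -[E1 E2] [E3 E4]; congr pair.
    transitivity (((e' i0).1 + ((e' i1).1 + (e i2).1)) - (e' i1).1 - (e i2).1 - (m i0).1);
      first by ring.
    rewrite E1 (_ : D.1 = (m i0).1 + ((m i1).1 + (m i2).1) + n12.1 + n13.1 + n23.1);
      [ring|rewrite E3; ring].
  transitivity (((e' i0).2 + ((e' i1).2 + (e i2).2)) - (e' i1).2 - (e i2).2 - (m i0).2);
    first by ring.
  rewrite E2 (_ : D.2 = (m i0).2 + ((m i1).2 + (m i2).2) + n12.2 + n13.2 + n23.2);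
    [ring|rewrite E4; ring].
rewrite -scaler_suml; congr (_ *: _); rewrite -e'1 e'0.
set d := sub2 (e' i1) (m i1); set R := revdeg m (e i2).
have dE k' : (e' i1 == add2 (m i1) (nat2K K k')) = (d == nat2K K k').
  rewrite /d; apply/eqP/eqP => [->|<-]; first by pair_ring.
  by rewrite /sub2 /add2 /opp2 /= !subrKC; case: (e' i1).
(* Only an index equal to [d] can contribute to the sum; when the coefficient at [d] is nonzero, [d]
   is natural and lies in the box. *)
have [zero|] := eqVneq (sb2 n23 d * sb2 n13 (sub2 R d)) 0.
  rewrite zero mulr0 big1 // => k' _; rewrite dE; case: eqP => [E|_]; last by rewrite mul0r.
  by rewrite /psi /= mul1r -sb2_nat -E -/R zero mulr0.
move=> nz.
have /sb2_neq0[[a ha] [b hb]] : sb2 n23 d != 0.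
  by apply: contraNneq nz => ->; rewrite mul0r.
have /sb2_neq0[hc hd] : sb2 n13 (sub2 R d) != 0.
  by apply: contraNneq nz => ->; rewrite mulr0.
have dab : d = nat2K K (a, b) by rewrite /nat2K /= -ha -hb; case: (d).
rewrite (bigD1_seq (a, b)) ?pairs_iota_uniq //=; last first.
  by apply: box_mem => //=; [move: hc|move: hd]; rewrite dab.
rewrite dE dab eqxx mul1r big1 ?addr0 => [|k' nk'].
  by rewrite /psi /= sb2_nat.
rewrite dE dab; case: eqP => [[/(natr_injK char0) E1 /(natr_injK char0) E2]|_];
  last by rewrite mul0r.
by case/eqP: nk'; rewrite E1 E2; case: (k').
Qed.

Variable np : K * K.

Let M : K * K := sub2 (sub2 (opp2 n12) (one2 K)) np.

(** The Leibniz rule for [d_z^(M)] of [z^(m i0) (z-u)^n13] at [z = w], where [j] derivatives fall on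
    [(z-u)^n13]. The triples now describe a series in [w], [u] with powers of [w-u]. *)
Definition list_prod : seq (triple V) :=
  [seq ((sub2 (add2 n13 n23) (nat2K K j), m i2),
    (binK (m i0).1 (natof M.1 - j.1) * binK n13.1 j.1 *
     (binK (m i0).2 (natof M.2 - j.2) * binK n13.2 j.2)) *: f m)
  | m <- S, j <- box_if M].

(** The sum over [k] factors into two convolutions, one for each component of the exponents, and
    [leibniz_ext] evaluates both. *)
Lemma ev_list_id e2 : ev (Lprod (sub2 D e2) np) (list_id e2) = ev (Lexp e2) list_prod.
Proof.
rewrite /ev /list_id /list_prod !big_allpairs_dep /=; apply: eq_big_seq => m mS.
have := St mS; rewrite totdeg3 => -[E1 E2].
transitivity ((\sum_(k <- box (sub2 e2 (m i2)))
   (sbin n23.1 k.1 * sb n13.1 (e2.1 - (m i2).1 - k.1%:R) *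
      binKK ((m i0).1 + n13.1 - (e2.1 - (m i2).1 - k.1%:R)) M.1) *
   (sbin n23.2 k.2 * sb n13.2 (e2.2 - (m i2).2 - k.2%:R) *
      binKK ((m i0).2 + n13.2 - (e2.2 - (m i2).2 - k.2%:R)) M.2)) *: f m).
  rewrite scaler_suml; apply: eq_bigr => k _; rewrite scalerA; congr (_ *: _).
  rewrite /Lprod /bb2 -/M /sbin2 /sb2.
  rewrite (_ : (sub2 (sub2 _ _) _).1 = (m i0).1 + n13.1 - (e2.1 - (m i2).1 - k.1%:R)); last first.
    rewrite /= (_ : D.1 = (m i0).1 + ((m i1).1 + (m i2).1) + n12.1 + n13.1 + n23.1).
      ring.
    by move: E1 => /= ->; ring.
  rewrite (_ : (sub2 (sub2 _ _) _).2 = (m i0).2 + n13.2 - (e2.2 - (m i2).2 - k.2%:R)); last first.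
    rewrite /= (_ : D.2 = (m i0).2 + ((m i1).2 + (m i2).2) + n12.2 + n13.2 + n23.2).
      ring.
    by move: E2 => /= ->; ring.
  by rewrite /=; ring.
rewrite (sum_pairs _ _
   (fun k => sbin n23.1 k * sb n13.1 (e2.1 - (m i2).1 - k%:R) *
      binKK ((m i0).1 + n13.1 - (e2.1 - (m i2).1 - k%:R)) M.1)
   (fun k => sbin n23.2 k * sb n13.2 (e2.2 - (m i2).2 - k%:R) *
      binKK ((m i0).2 + n13.2 - (e2.2 - (m i2).2 - k%:R)) M.2)).
rewrite !leibniz_ext // -(sum_pairs _ _
  (fun j => binK (m i0).1 (natof M.1 - j) * binK n13.1 j *
     sb (n13.1 + n23.1 - j%:R) (e2.1 - (m i2).1))
  (fun j => binK (m i0).2 (natof M.2 - j) * binK n13.2 j *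
     sb (n13.2 + n23.2 - j%:R) (e2.2 - (m i2).2))).
rewrite scaler_suml; apply: eq_bigr => j _; rewrite scalerA; congr (_ *: _).
by rewrite /Lexp /sb2 /=; ring.
Qed.

Hypotheses (hn13 : Kint2 n13) (hn23 : Kint2 n23).

Lemma Kint2_list_prod_exponent j : Kint2 (sub2 (add2 n13 n23) (nat2K K j)).
Proof.
rewrite /Kint2 (_ : _ - _ = (n13.1 - n13.2) + (n23.1 - n23.2) - (j.1%:R - j.2%:R));
  last by rewrite /=; ring.
apply: intKB; first exact: intKD.
by apply: intKB; apply/intK_nat/natK_nat.
Qed.

Lemma Kint2_list_prod t : t \in list_prod -> Kint2 t.1.1.
Proof. by case/allpairsPdep=> m [j [_ _ ->]]; apply: Kint2_list_prod_exponent. Qed.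

(** As before, with [leibniz_ext_rev]. Its signs [(-1)^j] and those of the two reversed factors
    combine into the sign that [Lrev] attaches to the exponent [n13 + n23 - j]. *)
Lemma ev_list_rot e2 : ev (Lprod (sub2 D e2) np) (list_rot e2) = ev (Lrev e2) list_prod.
Proof.
rewrite /ev /list_rot /list_prod !big_allpairs_dep /=; apply: eq_big_seq => m mS.
have := St mS; rewrite totdeg3 => -[E1 E2].
set R := revdeg m e2.
transitivity ((sgn2 n13 * sgn2 n23) *: ((\sum_(k <- box R)
   (sbin n23.1 k.1 * sb n13.1 (R.1 - k.1%:R) * binKK ((m i0).1 + (R.1 - k.1%:R)) M.1) *
   (sbin n23.2 k.2 * sb n13.2 (R.2 - k.2%:R) * binKK ((m i0).2 + (R.2 - k.2%:R)) M.2)) *: f m)).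
  rewrite scaler_suml scaler_sumr; apply: eq_bigr => k _; rewrite !scalerA; congr (_ *: _).
  rewrite /Lprod /bb2 -/M /sbin2 /sb2.
  rewrite (_ : (sub2 (sub2 _ _) _).1 = (m i0).1 + (R.1 - k.1%:R)); last first.
    rewrite /= (_ : D.1 = (m i0).1 + ((m i1).1 + (m i2).1) + n12.1 + n13.1 + n23.1).
      ring.
    by move: E1 => /= ->; ring.
  rewrite (_ : (sub2 (sub2 _ _) _).2 = (m i0).2 + (R.2 - k.2%:R)); last first.
    rewrite /= (_ : D.2 = (m i0).2 + ((m i1).2 + (m i2).2) + n12.2 + n13.2 + n23.2).
      ring.
    by move: E2 => /= ->; ring.
  by rewrite /=; ring.
rewrite (sum_pairs _ _
   (fun k => sbin n23.1 k * sb n13.1 (R.1 - k%:R) * binKK ((m i0).1 + (R.1 - k%:R)) M.1)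
   (fun k => sbin n23.2 k * sb n13.2 (R.2 - k%:R) * binKK ((m i0).2 + (R.2 - k%:R)) M.2)).
rewrite !leibniz_ext_rev // -(sum_pairs _ _
  (fun j => binK (m i0).1 (natof M.1 - j) * binK n13.1 j *
     ((-1) ^+ j * sb (n13.1 + n23.1 - j%:R) (R.1 - j%:R)))
  (fun j => binK (m i0).2 (natof M.2 - j) * binK n13.2 j *
     ((-1) ^+ j * sb (n13.2 + n23.2 - j%:R) (R.2 - j%:R)))).
rewrite scaler_suml scaler_sumr; apply: eq_bigr => j _; rewrite !scalerA; congr (_ *: _).
rewrite /Lrev asboolT; last exact: Kint2_list_prod_exponent.
have -> : sgnK ((sub2 (add2 n13 n23) (nat2K K j)).1 - (sub2 (add2 n13 n23) (nat2K K j)).2)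
    = sgn2 n13 * sgn2 n23 * ((-1) ^+ j.1 * (-1) ^+ j.2).
  have ij (i : nat) : intK (i%:R : K) by apply/intK_nat/natK_nat.
  rewrite (_ : _ - _ = (n13.1 - n13.2) + (n23.1 - n23.2) + (- j.1%:R + j.2%:R));
    last by rewrite /=; ring.
  rewrite sgnKD //; [|exact: intKD|by apply: intKD => //; apply: intKN].
  rewrite [sgnK (n13.1 - n13.2 + _)]sgnKD // [sgnK (- _ + _)]sgnKD //; last exact: intKN.
  by rewrite sgnKN // !sgnK_nat.
have -> : sub2 (add2 (sub2 (add2 n13 n23) (nat2K K j)) (m i2)) e2 = sub2 R (nat2K K j).
  rewrite /R /revdeg; pair_ring.
by rewrite /sb2 /=; ring.
Qed.

End ThreeVariables.

Lemma opp2K (K : fieldType) : involutive (@opp2 K).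
Proof. by move=> [x y]; rewrite /opp2 /= !opprK. Qed.

Lemma sub2K (K : fieldType) (x y : K * K) : add2 (sub2 x y) y = x.
Proof. by rewrite /add2 /= !subrK -surjective_pairing. Qed.

Lemma koszul_id (K : fieldType) r (par : 'I_r -> bool) : koszul K par 1%g = 1.
Proof.
rewrite /koszul eq_card0 // => -[i j]; apply/negP; rewrite unfold_in => /asboolP /=.
by rewrite invg1 !perm1; case: ltngtP.
Qed.

Lemma koszul_rot3 (K : fieldType) (par : 'I_3 -> bool) :
  koszul K par rot3 = (-1) ^+ ((par i0 && par i2) + (par i1 && par i2))%N.
Proof.
rewrite /koszul -sum1_card; congr (_ ^+ _).
have big3 (F : 'I_3 -> nat) : (\sum_i F i = F i0 + (F i1 + F i2))%N.
  by rewrite -big_enum /= enum3 !big_cons big_nil addn0.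
rewrite big_mkcond /= (eq_bigr (fun p : 'I_3 * 'I_3 => ([&& (p.1 < p.2)%N,
  ((rot3^-1)%g p.2 < (rot3^-1)%g p.1)%N, par p.1 & par p.2] : nat))); last first.
  by move=> p _; rewrite unfold_in /in_set /= asboolb; case: ifP.
rewrite -(pair_bigA _ (fun i j : 'I_3 => ([&& (i < j)%N,
  ((rot3^-1)%g j < (rot3^-1)%g i)%N, par i & par j] : nat))) /=.
by rewrite !big3 !rot3VE /= !add0n !addn0.
Qed.

Section Linear.
Variables (K : fieldType) (V : lmodType K) (g : V -> V).
Hypothesis glin : is_lin g.

Lemma lin0 : g 0 = 0.
Proof. by have := glin (-1) 0 0; rewrite scaler0 add0r scaleN1r addNr. Qed.

Lemma linD x y : g (x + y) = g x + g y.
Proof. by have := glin 1 x y; rewrite !scale1r. Qed.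

Lemma linZ k x : g (k *: x) = k *: g x.
Proof. by have := glin k x 0; rewrite !addr0 lin0 addr0. Qed.

Lemma linB x y : g (x - y) = g x - g y.
Proof. by rewrite linD -scaleN1r linZ scaleN1r. Qed.

Lemma lin_sum (I : Type) (r : seq I) (F : I -> V) :
  g (\sum_(i <- r) F i) = \sum_(i <- r) g (F i).
Proof. by elim: r => [|i r IHr]; rewrite ?big_nil ?lin0 // !big_cons linD IHr. Qed.

Lemma iter_lin n : is_lin (iter n g).
Proof. by elim: n => [|n IHn] k x y //=; rewrite IHn glin. Qed.

End Linear.

(** * Products of fields *)

Section OpeLists.
Variables (K : fieldType) (V : lmodType K).
Hypothesis char0 : [pchar K] =i pred0.

Lemma ev_lin (L : K * K -> K * K -> K) (g : V -> V) (l : seq (triple V)) : is_lin g ->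
  ev L [seq (t.1, g t.2) | t <- l] = g (ev L l).
Proof.
move=> glin; rewrite ev_map /ev /=.
by elim: l => [|t l IHl]; rewrite ?big_nil ?(lin0 glin) // !big_cons glin IHl.
Qed.

(** The lists of the single OPE terms are concatenated, so that one list represents [A(z) B(w) v] in
    total degree [D]. *)
Lemma ope_list (p q : bool) (A B : fld K V 1) N (h : 'I_N -> K * K) c v D :
  ope_decomp p q A B h c -> exists l : seq (triple V),
  [/\ forall t, t \in l -> Kint2 t.1.1,
      forall e e', add2 e e' = D -> A (e1 e) (B (e1 e') v) = ev (Lexp e') l,
      forall e e', add2 e e' = D ->
        (-1) ^+ (p && q) *: B (e1 e') (A (e1 e) v) = ev (Lrev e') l &
      forall np x, D = sub2 (sub2 x (one2 K)) np ->
        nprod_of h c np (e1 x) v = ev (Lprod D np) l].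
Proof.
move=> [hK [hc hAB]].
have [l hl] := choice (fun i => pair_list char0 (opp2 (h i)) D ((hc i).2 v)).
have hN i : Kint2 (opp2 (h i)).
  by rewrite /Kint2 /= -opprD; apply: intKN; apply: hK.
exists (flatten [seq l i | i <- enum 'I_N]); split.
- by move=> t /flatten_mapP[i _ ti]; have [-> //] := hl i.
- move=> e e' eD; rewrite ev_flatten big_enum /=.
  have [/(congr1 (fun F => F (mk2 e e'))) /= E _] := hAB v.
  rewrite -[LHS]/(app (prod2 A B) v (mk2 e e')) E; apply: eq_bigr => i _.
  by have [_ -> //] := hl i; rewrite totdeg_mk2.
- move=> e e' eD; rewrite ev_flatten big_enum /=.
  have [_ /(congr1 (fun F => F (mk2 e e'))) /= E] := hAB v.
  rewrite -[LHS]/((-1) ^+ (p && q) *: app (prod2r A B) v (mk2 e e')) E.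
  apply: eq_bigr => i _.
  by have [_ _ hr _] := hl i; rewrite hr ?totdeg_mk2.
- move=> np x Dx; rewrite ev_flatten big_enum /= /nprod_of; apply: eq_bigr => i _.
  by have [_ _ _ /(_ np x Dx)] := hl i; rewrite opp2K.
Qed.

(** The product is determined by the expansion of [A(z) B(w) v], whose additivity in [v] comes from
    [A] and [B]. *)
Lemma nprod_add (p q : bool) (A B : fld K V 1) N (h : 'I_N -> K * K) c np x v w :
  (forall e, is_lin (A e)) -> (forall e, is_lin (B e)) -> ope_decomp p q A B h c ->
  nprod_of h c np (e1 x) (v + w) = nprod_of h c np (e1 x) v + nprod_of h c np (e1 x) w.
Proof.
move=> linA linB hAB; pose D := sub2 (sub2 x (one2 K)) np.
have [l1 [_ E1 _ ->//]] := ope_list v D hAB.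
have [l2 [_ E2 _ ->//]] := ope_list w D hAB.
have [l3 [_ E3 _ ->//]] := ope_list (v + w) D hAB.
rewrite -ev_cat; apply: ev_unique => //; last exact: admissible_Lprod.
move=> e'; have eD : add2 (sub2 D e') e' = D by exact: sub2K.
rewrite ev_cat -(E1 _ _ eD) -(E2 _ _ eD) -(E3 _ _ eD).
by rewrite -[v]scale1r linB linA !scale1r.
Qed.

(* Dong's lemma, on the single vector [v]. *)
Lemma dong_list (par : 'I_3 -> bool) (a : 'I_3 -> fld K V 1) p q N (h : 'I_N -> K * K) c np v D :
  (forall e, is_lin (a i2 e)) ->
  ope_decomp p q (a i0) (a i1) h c -> mlocal_hom par a ->
  exists l : seq (triple V),
  [/\ forall t, t \in l -> Kint2 t.1.1,
      forall e e', add2 e e' = D ->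
        nprod_of h c np (e1 e) (a i2 (e1 e') v) = ev (Lexp e') l &
      forall e e', add2 e e' = D ->
        (-1) ^+ ((par i0 && par i2) + (par i1 && par i2))%N
          *: a i2 (e1 e') (nprod_of h c np (e1 e) v) = ev (Lrev e') l].
Proof.
move=> linX hAB [M [H [d [hH [hd hm]]]]].
pose D3 := sub2 (sub2 D (one2 K)) np.
pose n12 i := opp2 (H i i0 i1); pose n13 i := opp2 (H i i0 i2); pose n23 i := opp2 (H i i1 i2).
have [S hS] := choice (fun i => homogeneous_monomials char0
   (sub2 (sub2 (sub2 D3 (n12 i)) (n13 i)) (n23 i)) ((hd i).2 v)).
have KN x : Kint2 x -> Kint2 (opp2 x) by rewrite /Kint2 /= -opprD; apply: intKN.
pose mk3 (x y z : K * K) : expo K 3 := fun l => if l == i0 then x else if l == i1 then y else z.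
exists (flatten [seq list_prod (app (d i) v) (S i) (n12 i) (n13 i) (n23 i) np | i <- enum 'I_M]).
split.
- by move=> t /flatten_mapP[i _]; apply: Kint2_list_prod; apply: KN; apply: hH.
- move=> e e' eD.
  have [l [_ E1 _ E2]] := ope_list (a i2 (e1 e') v) (sub2 D3 e') hAB.
  have DD : sub2 D3 e' = sub2 (sub2 e (one2 K)) np.
    by rewrite /D3 -eD /sub2 /add2 /opp2 /=; congr pair; ring.
  rewrite (E2 _ _ DD) ev_flatten.
  rewrite (eq_bigr (fun i => ev (Lprod (sub2 D3 e') np)
    (list_id (app (d i) v) (S i) (n12 i) (n13 i) (n23 i) e'))); last first.
    by move=> i _; rewrite (ev_list_id _ _ (hS i).1).
  rewrite -(ev_flatten _ (fun i => list_id (app (d i) v) (S i) (n12 i) (n13 i) (n23 i) e')).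
  (* For a fixed exponent of [u], the OPE of the first two fields on [x(u) v] and the slice of the
     triple OPE have the same expansion in [z], [w], hence the same product. *)
  apply: ev_unique => //; last exact: admissible_Lprod.
  move=> x; rewrite -(E1 (sub2 (sub2 D3 e') x)); last exact: sub2K.
  have /(congr1 (fun F => F (mk3 (sub2 (sub2 D3 e') x) x e'))) := hm 1%g v.
  rewrite koszul_id scale1r /mprod enum3 /= !perm1 => ->.
  rewrite ev_flatten big_enum /=; apply: eq_bigr => i _.
  rewrite mulprod_id3 (mulpow_id3 char0 (hS i).1 (hS i).2) //.
  by rewrite totdeg3 /mk3 /= add2A !sub2K.
- move=> e e' eD.
  have [l [_ E1 _ E2]] := ope_list v (sub2 D3 e') hAB.
  have DD : sub2 D3 e' = sub2 (sub2 e (one2 K)) np.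
    by rewrite /D3 -eD /sub2 /add2 /opp2 /=; congr pair; ring.
  (* The sign and the coefficient of [x(u)] form a linear map, which can be applied to the vectors
     of the OPE list on [v]. *)
  pose g w := (-1) ^+ ((par i0 && par i2) + (par i1 && par i2))%N *: a i2 (e1 e') w.
  have ling : is_lin g.
    by move=> k x y; rewrite /g linX scalerDr !scalerA mulrC.
  rewrite -/(g _) (E2 _ _ DD) -(ev_lin _ _ ling) ev_flatten.
  rewrite (eq_bigr (fun i => ev (Lprod (sub2 D3 e') np)
    (list_rot (app (d i) v) (S i) (n12 i) (n13 i) (n23 i) e'))); last first.
    by move=> i _; rewrite (ev_list_rot _ _ (hS i).1) //; apply: KN; apply: hH.
  rewrite -(ev_flatten _ (fun i => list_rot (app (d i) v) (S i) (n12 i) (n13 i) (n23 i) e')).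
  apply: ev_unique => //; last exact: admissible_Lprod.
  move=> x; rewrite ev_lin // -(E1 (sub2 (sub2 D3 e') x)); last exact: sub2K.
  have /(congr1 (fun F => F (mk3 (sub2 (sub2 D3 e') x) x e'))) := hm rot3 v.
  rewrite koszul_rot3 /mprod enum3 /= !rot3E /= => E.
  rewrite /g E ev_flatten big_enum /=; apply: eq_bigr => i _.
  rewrite mulprod_rot3 (mulpow_rot3 char0 (hS i).1 (hS i).2) //.
  by rewrite totdeg3 /mk3 /= add2A !sub2K.
Qed.

(** Each of the finitely many shifted power series bounds the exponents [D - k] from below, hence
    [k] from above. *)
Lemma lser1_bound (f : ser K V 1) D : in_lser f -> exists B : nat,
  forall k : nat * nat, f (e1 (sub2 D (nat2K K k))) != 0 -> (k.1 < B)%N && (k.2 < B)%N.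
Proof.
move=> [N [m [g [hg ->]]]].
pose Bd (j : 'I_N) := (maxn (natof (D.1 - (m j ord0).1)) (natof (D.2 - (m j ord0).2))).+1.
exists (\max_j Bd j) => k nz.
have [j gj] : exists j, shiftm (m j) (g j) (e1 (sub2 D (nat2K K k))) != 0.
  apply: contrapT => nj; case/eqP: nz; apply: big1 => j _.
  by apply/eqP; apply: contrapT => /negP gj; apply: nj; exists j.
have [/= h1 h2] := hg j _ gj ord0.
have {}h1 : natK (D.1 - (m j ord0).1 - k.1%:R) by move: h1; rewrite addrAC.
have {}h2 : natK (D.2 - (m j ord0).2 - k.2%:R) by move: h2; rewrite addrAC.
have [_ b1] := natK_le char0 h1; have [_ b2] := natK_le char0 h2.
have le_j := @leq_bigmax _ Bd j.
by apply/andP; split; apply: leq_trans le_j; rewrite ltnS leq_max ?b1 ?b2 ?orbT.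
Qed.

(** A family with one member has no factors [z_i - z_j], so multiple locality presents it as a
    finite sum of fields. *)
Lemma mlocal1_bound (par : 'I_1 -> bool) (a : 'I_1 -> fld K V 1) v D : mlocal_hom par a ->
  exists B : nat, forall k : nat * nat,
    a ord0 (e1 (sub2 D (nat2K K k))) v != 0 -> (k.1 < B)%N && (k.2 < B)%N.
Proof.
move=> [M [H [d [_ [hd hm]]]]].
have [B hB] := choice (fun i => lser1_bound D ((hd i).2 v)).
exists (\max_i B i) => k nz.
have e1E : enum 'I_1 = [:: ord0].
  by apply: (inj_map val_inj); rewrite val_enum_ord.
have /(congr1 (fun F => F (e1 (sub2 D (nat2K K k))))) := hm 1%g v.
rewrite koszul_id scale1r /mprod e1E /= perm1 => E.
have [i di] : exists i, app (d i) v (e1 (sub2 D (nat2K K k))) != 0.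
  apply: contrapT => nj; case/eqP: nz; rewrite [LHS]E big1 // => j _.
  rewrite /mulprod_s e1E /=.
  by apply/eqP; apply: contrapT => /negP gj; apply: nj; exists j.
have /andP[b1 b2] := hB i k di.
have le_i := @leq_bigmax _ B i.
by rewrite (leq_trans b1 le_i) (leq_trans b2 le_i).
Qed.

End OpeLists.

(** * Translation by an exponential *)

Section Translation.
Variables (K : fieldType) (V : lmodType K).
Hypothesis char0 : [pchar K] =i pred0.

(* [G(z) e^{wT} = e^{wT} G(z - w)], coefficient of [w^E]. *)
Lemma translation_expand (T : V -> V) (G : K -> V -> V) :
  is_lin T -> (forall x, is_lin (G x)) ->
  (forall x v, G x (T v) = T (G x v) - (x + 1) *: G (x + 1) v) ->
  forall E x v, E`!%:R^-1 *: G x (iter E T v)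
    = \sum_(k < E.+1) sbin (x + k%:R) k
        *: ((E - k)`!%:R^-1 *: iter (E - k) T (G (x + k%:R) v)).
Proof.
move=> linT linG GT; elim=> [|E IHE] x v.
  by rewrite big_ord1 /= addr0 /sbin binK0 mulr1 scale1r.
pose t k := iter (E.+1 - k) T (G (x + k%:R) v).
pose S (k : nat) := sbin (x + k%:R) k *: ((E.+1 - k)`!%:R^-1 *: t k).
rewrite iterSr factS natrM invfM -scalerA IHE.
(* The factor [E + 1 = (E + 1 - k) + k] splits the right side into the part where [T] is pulled out
   and the part where [x] is shifted. *)
apply: (scalerI (natrS_neq0 char0 E)); rewrite scalerA divff ?natrS_neq0 // scale1r.
transitivity (\sum_(k < E.+2) (E.+1 - k)%:R *: S k + \sum_(k < E.+2) k%:R *: S k); last first.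
  rewrite -big_split /= scaler_sumr; apply: eq_bigr => k _.
  by rewrite -scalerDl -natrD subnK // -ltnS.
rewrite [X in X + _]big_ord_recr /= subnn scale0r addr0.
rewrite [X in _ + X]big_ord_recl /= scale0r add0r -big_split /=.
apply: eq_bigr => k _; have kE : (k <= E)%N by rewrite -ltnS.
have linTk : is_lin (iter (E - k) T) by apply: iter_lin.
rewrite GT (linB linTk) (linZ linTk) -iterSr -subSn // -/(t k).
rewrite /bump /= add1n {2}/S /t subSS -addrA natr1 !scalerBr; congr (_ + _).
  rewrite /S !scalerA; congr (_ *: _).
  rewrite subSn // factS natrM invfM.
  transitivity (((E - k).+1%:R / (E - k).+1%:R) * (sbin (x + k%:R) k / (E - k)`!%:R)); last by ring.
  by rewrite divff ?natrS_neq0 // mul1r.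
rewrite -scalerN -scaleNr !scalerA; congr (_ *: _).
rewrite /sbin exprS -natr1 addrA.
transitivity (- (-1) ^+ k * (binK (x + k%:R + 1) k.+1 * k.+1%:R) / (E - k)`!%:R); last first.
  by rewrite -natr1; ring.
by rewrite binKS_absorb //; ring.
Qed.

End Translation.

(** * OPE-algebras *)

Section OpeAlgebra.
Variables (K : fieldType) (V : lmodType K) (sigma : V -> V).
Variables (prod : K * K -> V -> V -> V) (T Tb : V -> V) (one : V).
Hypothesis char0 : [pchar K] =i pred0.
Hypothesis HV : OPE_algebra sigma prod T Tb one.

Let sigma_lin : is_lin sigma. Proof. by case: HV => -[]. Qed.
Let sigmaK v : sigma (sigma v) = v. Proof. by case: HV => -[]. Qed.
Let prodr_lin n a : is_lin (prod n a). Proof. by case: HV => _ [[]]. Qed.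
Let prodl_lin n b : is_lin (prod n ^~ b). Proof. by case: HV => _ [[_ []]]. Qed.
Let prod_even n a b : sigma (prod n a b) = prod n (sigma a) (sigma b).
Proof. by case: HV => _ [[_ []]]. Qed.
Let T_lin : is_lin T. Proof. by case: HV => _ [_ [[]]]. Qed.
Let Tb_lin : is_lin Tb. Proof. by case: HV => _ [_ [[]]]. Qed.
Let T_comm a e v : T (Y prod a e v) - Y prod a e (T v)
  = ((e ord0).1 + 1) *: Y prod a (e1 (add2 (e ord0) (1, 0))) v.
Proof. by case: HV => _ [_ [_ [[]]]]. Qed.
Let Tb_comm a e v : Tb (Y prod a e v) - Y prod a e (Tb v)
  = ((e ord0).2 + 1) *: Y prod a (e1 (add2 (e ord0) (0, 1))) v.
Proof. by case: HV => _ [_ [_ [[]]]]. Qed.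
Let sigma_one : sigma one = one. Proof. by case: HV => _ [_ [_ [_ [[]]]]]. Qed.
Let T_one : T one = 0. Proof. by case: HV => _ [_ [_ [_ [[]]]]]. Qed.
Let Tb_one : Tb one = 0. Proof. by case: HV => _ [_ [_ [_ [[]]]]]. Qed.
Let Y_one_pser a : is_pser (app (Y prod a) one).
Proof. by case: HV => _ [_ [_ [_ [[]]]]]. Qed.
Let prod_one a : prod (opp2 (one2 K)) a one = a.
Proof. by case: HV => _ [_ [_ [_ [[]]]]]. Qed.
Let Y_local a b : local sigma (Y prod a) (Y prod b).
Proof. by case: HV => _ [_ [_ [_ []]]]. Qed.

Lemma Y_lin a e : is_lin (Y prod a e). Proof. exact: prodr_lin. Qed.

(** The coefficients of [e^(zT)] in the variable pair, with [T] and [Tb] acting for its two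
    members. *)
Definition Tdiv (k : nat * nat) (v : V) : V :=
  k.1`!%:R^-1 *: iter k.1 T (k.2`!%:R^-1 *: iter k.2 Tb v).

Lemma Tdiv_lin k : is_lin (Tdiv k).
Proof.
move=> c x y; rewrite /Tdiv (iter_lin Tb_lin) !scalerDr (linD (iter_lin T_lin _)).
rewrite scalerDr; congr (_ + _); rewrite scalerA mulrC -scalerA (linZ (iter_lin T_lin _)).
by rewrite !scalerA mulrC.
Qed.

Lemma Y_vacuum0 a : Y prod a (e1 (0, 0)) one = a.
Proof.
rewrite /Y (_ : sub2 _ _ = opp2 (one2 K)) ?prod_one //.
by rewrite /sub2 /add2 /opp2 /= oppr0 !add0r.
Qed.

(** This is [Y(a)(z) 1 = e^(zT) a]. As [T] and [Tb] kill the vacuum, their commutators with [Y(a)]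
    give a recursion on the coefficients. *)
Lemma Y_vacuum a (k : nat * nat) : Y prod a (e1 (nat2K K k)) one = Tdiv k a.
Proof.
case: k => k k'; rewrite /nat2K /Tdiv /=.
have -> : k'`!%:R^-1 *: iter k' Tb a = Y prod a (e1 (0, k'%:R)) one.
  elim: k' => [|k' IHk]; first by rewrite fact0 invr1 scale1r Y_vacuum0.
  have := Tb_comm a (e1 (0, k'%:R)) one; rewrite Tb_one (lin0 (Y_lin _ _)) subr0 /= /add2 /=.
  rewrite addr0 natr1 -IHk (linZ Tb_lin) => /(congr1 (fun v => k'.+1%:R^-1 *: v)).
  by rewrite !scalerA mulVf ?natrS_neq0 // scale1r => <-; rewrite factS natrM invfM.
elim: k => [|k IHk]; first by rewrite fact0 invr1 scale1r.
have := T_comm a (e1 (k%:R, k'%:R)) one; rewrite T_one (lin0 (Y_lin _ _)) subr0 /= /add2 /=.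
rewrite addr0 natr1 IHk (linZ T_lin) => /(congr1 (fun v => k.+1%:R^-1 *: v)).
by rewrite !scalerA mulVf ?natrS_neq0 // scale1r => <-; rewrite factS natrM invfM.
Qed.

Lemma Y_vacuum_out a e : ~ (natK e.1 /\ natK e.2) -> Y prod a (e1 e) one = 0.
Proof.
move=> ne; apply/eqP; apply: contrapT => /negP /(Y_one_pser (a := a)) /(_ ord0) [] ? ?.
exact: ne.
Qed.

Lemma Tdiv_translation a b (E : nat * nat) e :
  Y prod a (e1 e) (Tdiv E b)
  = \sum_(k < E.1.+1) \sum_(k' < E.2.+1)
      (sbin (e.1 + k%:R) k * sbin (e.2 + k'%:R) k')
        *: Tdiv ((E.1 - k)%N, (E.2 - k')%N) (Y prod a (e1 (e.1 + k%:R, e.2 + k'%:R)) b).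
Proof.
case: E e => E E' [x x'] /=; rewrite /Tdiv /= (linZ (Y_lin _ _)).
rewrite (@translation_expand _ _ char0 T (fun y => Y prod a (e1 (y, x')))) //; first last.
- move=> y v; have := T_comm a (e1 (y, x')) v; rewrite /add2 /= addr0 => <-.
  by rewrite opprB subrKC.
- by move=> y; apply: Y_lin.
apply: eq_bigr => k _.
rewrite (linZ (Y_lin _ _)).
rewrite (@translation_expand _ _ char0 Tb (fun y => Y prod a (e1 (x + k%:R, y)))) //; first last.
- move=> y v; have := Tb_comm a (e1 (x + k%:R, y)) v; rewrite /add2 /= addr0 => <-.
  by rewrite opprB subrKC.
- by move=> y; apply: Y_lin.
have linTk := iter_lin T_lin (E - k).
rewrite (lin_sum linTk) !scaler_sumr; apply: eq_bigr => k' _.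
by rewrite (linZ linTk) !scalerA; congr (_ *: _); ring.
Qed.

(* [a(z) b(w) 1 = \sum_l w^l (z - w)^{D - l} T^(l) a_{D - l} b], degree [D]. *)
Lemma vacuum_list a b D (B : nat) :
  (forall k : nat * nat, Y prod a (e1 (sub2 D (nat2K K k))) b != 0 ->
     (k.1 < B)%N && (k.2 < B)%N) ->
  exists l : seq (triple V),
  (forall e e', add2 e e' = D ->
     Y prod a (e1 e) (Y prod b (e1 e') one) = ev (Lexp e') l) /\
  forall np x, D = sub2 (sub2 x (one2 K)) np ->
    ev (Lprod D np) l = Y prod (prod np a b) (e1 x) one.
Proof.
move=> hB; pose u (k : nat * nat) := Tdiv k (Y prod a (e1 (sub2 D (nat2K K k))) b).
have uB k : u k != 0 -> k \in pairs (iota 0 B) (iota 0 B).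
  move=> nz; have /hB /andP[h1 h2] : Y prod a (e1 (sub2 D (nat2K K k))) b != 0.
    by apply: contraNneq nz => z; rewrite /u z (lin0 (@Tdiv_lin k)).
  by rewrite mem_pairs_iota h1.
have uniqB := pairs_iota_uniq B B.
exists [seq ((sub2 D (nat2K K k), nat2K K k), u k) | k <- pairs (iota 0 B) (iota 0 B)].
split=> [e e' eD|np x Dx]; rewrite ev_map /=.
  have [[[E h1] [E' h2]]|ne] := pselect (natK e'.1 /\ natK e'.2); last first.
    rewrite Y_vacuum_out // (lin0 (Y_lin _ _)) big1 // => k _.
    rewrite /Lexp; set c := sb2 _ _.
    have [->|/sb2_neq0[/= h1 h2]] := eqVneq c 0; first by rewrite scale0r.
    by case: ne; have [] := natK_le char0 h1; have [] := natK_le char0 h2.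
  have e'E : e' = nat2K K (E, E') by rewrite /nat2K /= -h1 -h2; case: (e').
  rewrite e'E Y_vacuum Tdiv_translation /=.
  pose F (k : nat * nat) := Lexp (nat2K K (E, E')) (sub2 D (nat2K K k)) (nat2K K k) *: u k.
  rewrite -[RHS]/(\sum_(k <- pairs (iota 0 B) (iota 0 B)) F k) -(fsum_seq (F := F)) //; last first.
    by move=> k nz; apply: uB; apply: contraNneq nz => z; rewrite /F z scaler0.
  rewrite (@fsum_seq _ _ (pairs (iota 0 E.+1) (iota 0 E'.+1))); first last.
  - move=> k nz.
    have /sb2_neq0[h h'] : sb2 (sub2 D (nat2K K k)) (sub2 (nat2K K (E, E')) (nat2K K k)) != 0.
      by apply: contraNneq nz => z; rewrite /F /Lexp z scale0r.
    have [_ b1] := natK_le char0 (h : natK (E%:R - k.1%:R)).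
    have [_ b2] := natK_le char0 (h' : natK (E'%:R - k.2%:R)).
    rewrite !natof_nat // in b1 b2.
    by rewrite mem_pairs_iota !ltnS b1.
  - exact: pairs_iota_uniq.
  rewrite big_allpairs_dep -[iota 0 E.+1]/(index_iota 0 E.+1).
  rewrite -[iota 0 E'.+1]/(index_iota 0 E'.+1) big_mkord.
  (* [Tdiv_translation] counts the shift of the exponent and the list counts the power of [T]; the
     two indices add up to [E]. *)
  rewrite (reindex_inj rev_ord_inj) /=; apply: eq_bigr => k _.
  have kE : (k <= E)%N by rewrite -ltnS.
  rewrite big_mkord (reindex_inj rev_ord_inj) /=; apply: eq_bigr => k' _.
  have kE' : (k' <= E')%N by rewrite -ltnS.
  rewrite !subSS !subKn // /F /u /Lexp /sb2 /= -!natrB // /sb !ext_nat //.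
  have [D1 D2] : D.1 = e.1 + E%:R /\ D.2 = e.2 + E'%:R by rewrite -eD e'E.
  have -> : e.1 + (E - k)%:R = D.1 - k%:R by rewrite D1 natrB //; ring.
  have -> : e.2 + (E' - k')%:R = D.2 - k'%:R by rewrite D2 natrB //; ring.
  by [].
(* Here [s + q = D], so the binomials have upper entry 0 and only the entry with [k = x]
   survives. *)
have LE (k : nat * nat) : Lprod D np (sub2 D (nat2K K k)) (nat2K K k)
    = (nat2K K k == x)%:R.
  rewrite /Lprod /bb2.
  rewrite (_ : (sub2 (sub2 D (sub2 D (nat2K K k))) (nat2K K k)).1 = 0); last by rewrite /=; ring.
  rewrite (_ : (sub2 (sub2 D (sub2 D (nat2K K k))) (nat2K K k)).2 = 0); last by rewrite /=; ring.
  rewrite (_ : sub2 _ np = sub2 (nat2K K k) x); last first.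
    by rewrite Dx /sub2 /add2 /opp2 /=; congr pair; ring.
  by rewrite !binKK0 // !subr_eq0 -natrM mulnb /nat2K [in RHS](surjective_pairing x) xpair_eqE.
pose F (k : nat * nat) := (nat2K K k == x)%:R *: u k.
rewrite (eq_bigr F) => [|k _]; last by rewrite LE.
rewrite -(fsum_seq (F := F)) //; last first.
  by move=> k nz; apply: uB; apply: contraNneq nz => z; rewrite /F z scaler0.
have [[[E h1] [E' h2]]|ne] := pselect (natK x.1 /\ natK x.2); last first.
  rewrite Y_vacuum_out // fsbig1 // => k _; rewrite /F; case: eqP => [E|]; rewrite ?scale0r //.
  by case: ne; rewrite -E; split; apply: natK_nat.
have xE : x = nat2K K (E, E') by rewrite /nat2K /= -h1 -h2; case: (x).
rewrite (@fsum_seq _ _ [:: (E, E')]) // => [|k]; last first.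
  rewrite /F xE; case: (nat2K K k =P nat2K K (E, E')) =>
    [[/(natr_injK char0) E1 /(natr_injK char0) E2] _|_].
    by rewrite inE -E1 -E2 -surjective_pairing.
  by rewrite scale0r eqxx.
rewrite big_seq1 /F -xE eqxx scale1r xE Y_vacuum /u; congr Tdiv.
rewrite /Y /=; congr (prod _ _ _); rewrite Dx xE /sub2 /add2 /opp2 /=.
by rewrite [RHS]surjective_pairing; congr pair; ring.
Qed.

(** The projection onto the part of parity [p]. *)
Definition hom (p : bool) (a : V) : V := 2%:R^-1 *: (a + (-1) ^+ p *: sigma a).

Lemma compf_Y p a : compf sigma p (Y prod a) = Y prod (hom p a).
Proof.
apply/funext => e; apply/funext => v; rewrite /compf /hom /Y prod_even sigmaK.
set n := sub2 _ _.
by rewrite (linZ (prodl_lin n v)) (linD (prodl_lin n v)) (linZ (prodl_lin n v)).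
Qed.

Lemma hom_sum a : a = hom false a + hom true a.
Proof.
rewrite /hom expr0 expr1 scale1r scaleN1r -scalerDr addrACA subrr addr0 -mulr2n.
by rewrite -scaler_nat scalerA mulVf ?scale1r // natr_eq0.
Qed.

Lemma sigma_hom (p : bool) a : sigma (hom p a) = (-1) ^+ p *: hom p a.
Proof.
rewrite /hom (linZ sigma_lin) (linD sigma_lin) (linZ sigma_lin) sigmaK.
rewrite [RHS]scalerA mulrC -scalerA; congr (_ *: _).
by rewrite scalerDr scalerA -expr2 sqrr_sign scale1r addrC.
Qed.

Lemma hom_id (p : bool) a : sigma a = (-1) ^+ p *: a -> hom p a = a.
Proof.
move=> E; rewrite /hom E scalerA -expr2 sqrr_sign scale1r -mulr2n -scaler_nat.
by rewrite scalerA mulVf ?scale1r // natr_eq0.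
Qed.

(* Goddard's uniqueness: [F] is only required to be local to [Y(v)] on the vacuum. *)
Lemma vacuum_determines (p r : bool) (y v : V) (F : K * K -> V -> V) D (l : seq (triple V)) :
  sigma y = (-1) ^+ p *: y ->
  (forall t, t \in l -> Kint2 t.1.1) ->
  (forall e e', add2 e e' = D -> F e (Y prod (hom r v) (e1 e') one) = ev (Lexp e') l) ->
  (forall e e', add2 e e' = D ->
     (-1) ^+ (p && r) *: Y prod (hom r v) (e1 e') (F e one) = ev (Lrev e') l) ->
  (forall e, F e one = Y prod y (e1 e) one) ->
  F D (hom r v) = Y prod y (e1 D) (hom r v).
Proof.
move=> hy lK E1 E2 E3.
have [N [h [c]]] := @Y_local y v p r; rewrite !compf_Y (hom_id hy) => hyv.
have [l' [l'K E1' E2' _]] := ope_list char0 one D hyv.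
(* The exponent [(0, 0)] of the second variable recovers [hom r v] from [Y (hom r v)] applied to the
   vacuum. *)
have D0 : add2 D (0, 0) = D by rewrite /add2 /= !addr0 -surjective_pairing.
have := E1 _ _ D0; rewrite Y_vacuum0 => ->.
have := E1' _ _ D0; rewrite Y_vacuum0 => ->.
(* In the opposite order [F] and [Y(y)] act on the vacuum first, where they agree. *)
apply: ev_unique_rev => // e.
by rewrite -(E2 (sub2 D e)) ?sub2K // -(E2' (sub2 D e)) ?sub2K // E3.
Qed.

Lemma Y_one_vacuum e : Y prod one (e1 e) one = if e == (0, 0) then one else 0.
Proof.
case: eqP => [->|ne]; first exact: Y_vacuum0.
have [[[k h1] [k' h2]]|nn] := pselect (natK e.1 /\ natK e.2); last by rewrite Y_vacuum_out.
have -> : e = nat2K K (k, k') by rewrite /nat2K /= -h1 -h2; case: (e).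
rewrite Y_vacuum /Tdiv /=.
have iter0 n (g : V -> V) : is_lin g -> iter n g 0 = 0 by move=> lg; apply: (lin0 (iter_lin lg _)).
case: k' h2 => [|k'] h2; last by rewrite iterSr Tb_one iter0 // scaler0 iter0 // scaler0.
case: k h1 => [|k] h1; last by rewrite fact0 invr1 scale1r iterSr T_one iter0 // scaler0.
by case: ne; rewrite [e]surjective_pairing h1 h2.
Qed.

(** [vacuum_determines] with the identity field as [F], which agrees with [Y(1)] on the vacuum by
    [Y_one_vacuum]. *)
Lemma Y_one : Y prod one = @idfield K V.
Proof.
apply/funext => e; apply/funext => v; pose x := e ord0.
rewrite -[LHS]/(Y prod one (e1 x) v) -[RHS]/(if x == (0, 0) then v else 0).
pose F (e : K * K) (w : V) : V := if e == (0, 0) then w else 0.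
suff H r : F x (hom r v) = Y prod one (e1 x) (hom r v).
  rewrite [in LHS](hom_sum v) (linD (Y_lin _ _)) -!H /F; case: ifP => _.
    by rewrite -hom_sum.
  by rewrite addr0.
(* The product with the identity field is a series in [w] alone, so degree [x] has the single term
   [w^x], with exponent 0 of [z - w]. *)
pose l := [:: ((0, 0), x, Y prod (hom r v) (e1 x) one)] : seq (triple V).
have sb20 (m : K * K) : sb2 (0, 0) m = (m == (0, 0))%:R.
  rewrite /sb2 /=; case: m => m m' /=; rewrite xpair_eqE.
  have [->|n1] := eqVneq m 0; last by rewrite (sb0_eq0 char0 n1) mul0r.
  have [->|n2] := eqVneq m' 0; last by rewrite (sb0_eq0 char0 n2) mulr0.
  by rewrite sb00 // mulr1.
have Kint0 : Kint2 ((0, 0) : K * K) by exists 0; rewrite /= subrr.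
apply: (@vacuum_determines false r one v F x l).
- by rewrite sigma_one scale1r.
- by move=> t; rewrite inE => /eqP ->.
- move=> e0 e' eD; rewrite /ev big_seq1 /Lexp /= sb20 /F -eD.
  rewrite (_ : sub2 e' (add2 e0 e') = opp2 e0); last first.
    by rewrite /sub2 /add2 /opp2 /=; congr pair; ring.
  rewrite (_ : (opp2 e0 == (0, 0)) = (e0 == (0, 0))); last first.
    by case: (e0) => a b; rewrite /opp2 !xpair_eqE /= !oppr_eq0.
  case: eqP => [->|_]; last by rewrite scale0r.
  by rewrite scale1r /add2 /= !add0r -surjective_pairing.
- move=> e0 e' eD; rewrite /ev big_seq1 /Lrev asboolT //= sb20 /F -eD.
  rewrite (_ : sub2 (add2 (0, 0) (add2 e0 e')) e' = e0); last first.
    by rewrite /sub2 /add2 /opp2 /= [RHS]surjective_pairing; congr pair; ring.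
  rewrite expr0 scale1r subrr -[X in sgnK X]/(0%:R) sgnK_nat // expr0 mul1r.
  case: eqP => [->|_]; last by rewrite (lin0 (Y_lin _ _)) scale0r.
  by rewrite scale1r /add2 /= !add0r -surjective_pairing.
- by move=> e0; rewrite Y_one_vacuum.
Qed.

Hypothesis HM : multiply_local sigma prod.

Lemma Y_bound p a b D : exists B : nat, forall k : nat * nat,
  Y prod (hom p a) (e1 (sub2 D (nat2K K k))) b != 0 -> (k.1 < B)%N && (k.2 < B)%N.
Proof.
have := @HM 1 (fun=> a) (fun=> p); rewrite /mlocal => /(mlocal1_bound char0 b D).
by rewrite compf_Y.
Qed.

(** Agreement on the vacuum comes from [vacuum_list]; [dong_list] and [vacuum_determines] extend it
    to every vector. *)
Lemma nprod_of_Y p q a b N (h : 'I_N -> K * K) c np :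
  ope_decomp p q (Y prod (hom p a)) (Y prod (hom q b)) h c ->
  nprod_of h c np = Y prod (prod np (hom p a) (hom q b)).
Proof.
move=> hab; set y := prod np (hom p a) (hom q b).
have hy : sigma y = (-1) ^+ (p (+) q) *: y.
  rewrite /y prod_even !sigma_hom (linZ (prodr_lin _ _)) (linZ (prodl_lin _ _)).
  by rewrite scalerA mulrC -signr_addb.
have vac x : nprod_of h c np (e1 x) one = Y prod y (e1 x) one.
  pose D := sub2 (sub2 x (one2 K)) np.
  have [B hB] := Y_bound p a (hom q b) D.
  have [l [E1 E2]] := vacuum_list hB.
  have [l' [_ E1' _ ->//]] := ope_list char0 one D hab.
  (* The OPE list and the translation list both expand to [a(z) b(w) 1], so they have the same
     product. *)
  rewrite -(E2 _ _ erefl); apply: ev_unique => //; last exact: admissible_Lprod.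
  by move=> e; rewrite -(E1 (sub2 D e)) ?sub2K // -(E1' (sub2 D e)) ?sub2K.
apply/funext => e; apply/funext => v; pose x := e ord0.
rewrite -[LHS]/(nprod_of h c np (e1 x) v) -[RHS]/(Y prod y (e1 x) v).
rewrite (hom_sum v) (nprod_add char0 _ _ _ _ _ _ hab); try exact: Y_lin.
suff H r : nprod_of h c np (e1 x) (hom r v) = Y prod y (e1 x) (hom r v).
  by rewrite !H (linD (Y_lin _ _)).
pose fam (k : 'I_3) := if k == i0 then a else if k == i1 then b else v.
pose par (k : 'I_3) := if k == i0 then p else if k == i1 then q else r.
have hm : mlocal_hom par (fun k => Y prod (hom (par k) (fam k))).
  by have := @HM 3 fam par; under [X in mlocal_hom _ X]funext => k do rewrite compf_Y.
have [|l [lK E1 E2]] := dong_list (a := fun k => Y prod (hom (par k) (fam k)))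
  char0 np one x _ hab hm; first by move=> ?; apply: Y_lin.
apply: (@vacuum_determines (p (+) q) r y v (fun e => nprod_of h c np (e1 e)) x l) => //.
move=> e0 e' eD; rewrite -(E2 e0 e' eD); congr (_ *: _).
(* The Koszul exponent [pr + qr] and the parity [(p + q) r] of the product against [v] agree modulo
   2. *)
by rewrite /par /=; case: (p); case: (q); case: (r); rewrite /= ?expr0 ?expr1 // -signr_odd.
Qed.

Lemma is_nprod_Y a b np :
  is_nprod sigma (Y prod a) (Y prod b) np (Y prod (prod np a b)).
Proof.
exists (fun p q => Y prod (prod np (hom p a) (hom q b))); split.
  move=> p q; split; first exact: Y_local.
  by move=> N h c; rewrite !compf_Y => /nprod_of_Y ->.
apply/funext => e; apply/funext => v; rewrite !big_bool /= /Y.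
set n := sub2 _ _; rewrite -!(linD (prodl_lin n v)); congr (prod n _ v).
rewrite -!(linD (prodr_lin np _)) -(linD (prodl_lin np _)).
by rewrite ![hom true _ + _]addrC -!hom_sum.
Qed.

(** The constant term of [Y(a)(z) 1] is [a]. *)
Lemma Y_inj : injective (Y prod).
Proof. by move=> a b /(congr1 (fun F => F (e1 (0, 0)) one)); rewrite !Y_vacuum0. Qed.

End OpeAlgebra.

Theorem theorem4p1 (K : fieldType) (V : lmodType K) (sigma : V -> V)
    (prod : K * K -> V -> V -> V) (T Tb : V -> V) (one : V) :
  [pchar K] =i pred0 ->
  OPE_algebra sigma prod T Tb one ->
  multiply_local sigma prod ->
  (* F_Y is closed under the products *)
  (forall (a b : V) (n : K * K), exists c : V,
      is_nprod sigma (Y prod a) (Y prod b) n (Y prod c)) /\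
  (* Y is bijective onto F_Y *)
  injective (Y prod) /\
  (* Y(a_(n) b) = Y(a)_(n) Y(b) *)
  (forall (a b : V) (n : K * K),
      is_nprod sigma (Y prod a) (Y prod b) n (Y prod (prod n a b))) /\
  (* Y(1) = id_V *)
  Y prod one = @idfield K V.
Proof.
move=> char0 HV HM; have H := is_nprod_Y char0 HV HM.
split; first by move=> a b n; exists (prod n a b).
by split; [apply: Y_inj HV|split; [|apply: Y_one char0 HV]].
Qed.
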